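(* Suppose that Assumption (A2) (see context) is satisfied (strictly or not) at a strong local minimum $x^\star$ of $\varphi$ at which $R_\gamma$ is Lipschitz-continuously semidifferentiable. Consider the iterates generated by the algorithm ZeroFPR (see context) with directions $d^k$ selected with the (modified) Broyden method (see context), and suppose that $x^k\to x^\star$. Then, the Dennis–Moré condition $$\lim_{k\to\infty}\frac{\|\bar r^k+JR_\gamma(x^\star)d^k\|}{\|d^k\|}=0$$ is satisfied, where $\bar r^k\in R_\gamma(\bar x^k)$ is the element used in the definition of $d^k$; and in particular, eventually stepsize $\tau_k=1$ is always accepted, and the sequences $(x^k)_{k\in\mathbb{N}}$, $(\bar x^k)_{k\in\mathbb{N}}$ and $(r^k)_{k\in\mathbb{N}}$ converge with superlinear rate.
   Context: Standing assumptions: $f:\mathbb{R}^n\to\mathbb{R}$ is differentiable with Lipschitz continuous gradient, $L_f$ denoting the Lipschitz modulus of $\nabla f$ (with $1/L_f=+\infty$ if $L_f=0$); $g:\mathbb{R}^n\to\mathbb{R}\cup\{+\infty\}$ is proper, lower semicontinuous and prox-bounded, meaning that $g+\frac{1}{2\gamma}\|\cdot\|^2$ is bounded below for some $\gamma>0$; $\gamma_g\in(0,+\infty]$ is the supremum of all such $\gamma$; $\varphi:=f+g$ and $\operatorname{argmin}\varphi\neq\emptyset$. Neither function need be convex. For $\gamma>0$: $\operatorname{prox}_{\gamma g}(y):=\operatorname{argmin}_z\{g(z)+\frac{1}{2\gamma}\|z-y\|^2\}$; $T_\gamma(x):=\operatorname{prox}_{\gamma g}(x-\gamma\nabla f(x))$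 and $R_\gamma(x):=\frac1\gamma(x-T_\gamma(x))$ (set-valued maps); $\varphi_\gamma(x):=\inf_{z}\{f(x)+\langle\nabla f(x),z-x\rangle+\frac{1}{2\gamma}\|z-x\|^2+g(z)\}$. $JR_\gamma(x^\star)$ is the Jacobian of $R_\gamma$ at $x^\star$. A point $x^\star\in\operatorname{dom}\varphi$ is critical if $x^\star\in T_{\gamma'}(x^\star)$ for some $\gamma'\in(0,\gamma_g)$. Algorithm ZeroFPR. Parameters: $\gamma\in(0,\min\{1/L_f,\gamma_g\})$, $\beta,p_{\min}\in(0,1)$, $\sigma\in(0,\gamma\frac{1-\gamma L_f}{2})$, $x^0\in\mathbb{R}^n$; $\bar\Phi_0=\varphi_\gamma(x^0)$. For $k=0,1,2,\dots$: (1) select $\bar x^k\in T_\gamma(x^k)$ and set $r^k=\frac1\gamma(x^k-\bar x^k)$; (2) if $r^k=0$ stop; (3) select a direction $d^k\in\mathbb{R}^n$; (4) let $\tau_k$ be the largest element of $\{\beta^m:m\in\mathbb{N}\}$ ($m\ge0$) such that $x^{k+1}=\bar x^k+\tau_kd^k$ satisfies $\varphi_\gamma(x^{k+1})\le\bar\Phi_k-\sigma\|r^k\|^2$; (5) set $\bar\Phi_{k+1}=(1-p_k)\bar\Phi_k+p_k\varphi_\gamma(x^{k+1})$ for some $p_k\in[p_{\min},1]$. It is assumed throughout that $r^k\ne0$ for all $k$, so that infinite sequences are generated. Modified Broyden directions: $d^k=-H_k\bar r^k$ for some $\bar r^k\in R_\gamma(\bar x^k)$, where $H_0\in\mathbb{R}^{n\times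 n}$ is invertible and $$H_{k+1}=H_k+\frac{s_k-H_ky_k}{\langle s_k,(1/\vartheta_k-1)s_k+H_ky_k\rangle}s_k^\top H_k,\qquad s_k=x^{k+1}-\bar x^k,\quad y_k=r^{k+1}-\bar r^k,$$ with, for a fixed $\bar\vartheta\in(0,1)$ and $\gamma_k:=\langle H_ky_k,s_k\rangle/\|s_k\|^2$: $\vartheta_k:=1$ if $|\gamma_k|\ge\bar\vartheta$, and $\vartheta_k:=\frac{1-\operatorname{sign}(\gamma_k)\bar\vartheta}{1-\gamma_k}$ if $|\gamma_k|<\bar\vartheta$ (convention $\operatorname{sign}0=1$). It is implicit in these formulas that $s_k\ne0$ (equivalently $d^k\neq0$) for all $k$. All matrices $H_k$ are then invertible. A sequence $(w^k)$ with $w^k\neq w^\star$ for all $k$ converges superlinearly to $w^\star$ if $\|w^{k+1}-w^\star\|/\|w^k-w^\star\|\to0$. A strong local minimum $x^\star$ of $h$ is a point for which there are $c>0$ and a neighborhood $U$ of $x^\star$ with $h(x)\ge h(x^\star)+c\|x-x^\star\|^2$ for all $x\in U$. Lipschitz-continuous semidifferentiability: a map $F$, single-valued near $x$, is semidifferentiable at $x$ if for every $w$ the limit $DF(x)[w]:=\lim_{t\searrow0,\,w'\to w}\frac{F(x+tw')-F(x)}{t}$ exists; $F$ is Lipschitz-continuously semidifferentiable at $x^\star$ if there are a neighborhood $U$ of $x^\star$ and $L\ge0$ such that $F$ is single-valued and semidifferentiable at every $x\in U$ and $\|DF(x)[w]-DF(x^\star)[w]\|\le L\|x-x^\star\|$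 for all $x\in U$ and all $w$ with $\|w\|=1$. $\partial g$ is the limiting subdifferential: $v\in\partial g(x)$ iff there are $x^j\to x$ with $g(x^j)\to g(x)$ and $v^j\to v$ with $v^j$ a regular (Fréchet) subgradient of $g$ at $x^j$. $g$ is prox-regular at $x_0$ for $v_0\in\partial g(x_0)$ if there exist $\rho,\varepsilon>0$ such that $g(x')\ge g(x)+\langle v,x'-x\rangle-\frac\rho2\|x'-x\|^2$ for all $x'\in B(x_0;\varepsilon)$ and all $(x,v)$ with $v\in\partial g(x)$, $x\in B(x_0;\varepsilon)$, $v\in B(v_0;\varepsilon)$, $g(x)\le g(x_0)+\varepsilon$. For $v\in\partial g(x)$ and $\tau>0$ let $\Delta^2_\tau g(x|v)[d]:=\frac{g(x+\tau d)-g(x)-\tau\langle v,d\rangle}{\tau^2/2}$. $g$ is twice epi-differentiable at $x$ for $v$ if $\Delta^2_\tau g(x|v)$ epi-converges as $\tau\searrow0$ to a proper function, denoted $\mathrm{d}^2g(x|v)[\cdot]$; strictly twice epi-differentiable at $x$ for $v$ if $\Delta^2_\tau g(x'|v')$ epi-converges as $\tau\searrow0$ and $(x',v')\to(x,v)$ with $v'\in\partial g(x')$, $g(x')\to g(x)$. Assumption (A2) is satisfied at (with respect to) a critical point $x^\star$ if: $\nabla^2f$ exists and is continuous around $x^\star$; and $g$ is prox-regular and twice epi-differentiable at $x^\star$ for $-\nabla f(x^\star)$, with $\mathrm{d}^2g(x^\star|-\nabla f(x^\star))[d]=\langle d,Md\rangle+\delta_S(d)$ for all $d\in\mathbb{R}^n$,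 where $S\subseteq\mathbb{R}^n$ is a linear subspace, $\delta_S$ its indicator function ($0$ on $S$, $+\infty$ elsewhere), and $M\in\mathbb{R}^{n\times n}$; without loss of generality $M$ is symmetric with $\operatorname{Im}(M)\subseteq S$ and $\ker(M)\supseteq S^\perp$. It is strictly satisfied if, in addition, $\nabla^2 f$ is strictly continuous (i.e. locally Lipschitz) around $x^\star$ and $g$ is strictly twice epi-differentiable at $x^\star$ for $-\nabla f(x^\star)$. *)

(* Defs.v *)
From HB Require Import structures.
From mathcomp Require Import all_boot all_order all_algebra.
From mathcomp Require Import all_classical all_reals all_analysis.

Set Implicit Arguments.
Unset Strict Implicit.
Unset Printing Implicit Defensive.

Import Order.TTheory GRing.Theory Num.Theory.
Import numFieldNormedType.Exports.

Local Open Scope classical_set_scope.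
Local Open Scope ring_scope.

(* R^n is 'cV[R]_n.  The library's norm on matrices is the sup norm: it provides
   the topology and the derivatives, while all metric quantities below use the
   Euclidean norm [enorm]. *)

Section Euclidean.
Context {R : realType} {n : nat}.
Implicit Types (x y : 'cV[R]_n).

Definition dotp x y : R := (x^T *m y) 0 0.

Definition enorm x : R := Num.sqrt (dotp x x).

(* The library's Jacobian ['J F x] is for maps between row vectors and is the
   transpose of the usual one; these are the column versions. *)
Definition grad (f : 'cV[R]_n -> R) x : 'cV[R]_n :=
  \col_i 'D_(delta_mx i 0) f x.

Definition jac (F : 'cV[R]_n -> 'cV[R]_n) x : 'M[R]_n :=
  \matrix_(i, j) ('D_(delta_mx j 0) F x) i 0.

Definition hess (f : 'cV[R]_n -> R) x : 'M[R]_n := jac (grad f) x.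

Definition lipschitz_consts (F : 'cV[R]_n -> 'cV[R]_n) : set R :=
  [set L | 0 <= L /\ forall x y, enorm (F x - F y) <= L * enorm (x - y)].

Definition lipschitz_modulus (F : 'cV[R]_n -> 'cV[R]_n) : R :=
  inf (lipschitz_consts F).

Definition superlinear (w : nat -> 'cV[R]_n) (ws : 'cV[R]_n) : Prop :=
  (forall k, w k != ws) /\
  (fun k => enorm (w k.+1 - ws) / enorm (w k - ws)) @ \oo --> 0.

End Euclidean.

Section ExtendedValued.
Context {R : realType} {n : nat}.
Implicit Types (x y z v d : 'cV[R]_n) (h g : 'cV[R]_n -> \bar R).
Local Open Scope ereal_scope.

Definition proper_fun h : Prop :=
  (forall x, h x != -oo) /\ (exists x, h x != +oo).

Definition argmin h : set 'cV[R]_n := [set x | forall z, h x <= h z].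

Definition strong_local_min h x : Prop :=
  exists2 c : R, (0 < c)%R &
    \forall z \near x, h x + (c * enorm (z - x) ^+ 2)%:E <= h z.

Definition prox_bounded_at g (gam : R) : Prop :=
  (0 < gam)%R /\
  exists m : R, forall x, m%:E <= g x + ((2 * gam)^-1 * enorm x ^+ 2)%:E.

Definition prox_bounded g : Prop := exists gam, prox_bounded_at g gam.

Definition prox_threshold g : \bar R :=
  ereal_sup [set gam%:E | gam in prox_bounded_at g].

Definition prox g (gam : R) y : set 'cV[R]_n :=
  argmin (fun z => g z + ((2 * gam)^-1 * enorm (z - y) ^+ 2)%:E).

Definition regular_subgradient g x v : Prop :=
  g x \is a fin_num /\
  forall e : R, (0 < e)%R ->
    \forall z \near x,
      g x + (dotp v (z - x) - e * enorm (z - x))%:E <= g z.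

Definition limiting_subdiff g x : set 'cV[R]_n :=
  [set v | g x \is a fin_num /\
    exists xs vs : nat -> 'cV[R]_n,
      [/\ xs @ \oo --> x, g \o xs @ \oo --> g x, vs @ \oo --> v &
          forall j, regular_subgradient g (xs j) (vs j)]].

Definition prox_regular g x0 v0 : Prop :=
  limiting_subdiff g x0 v0 /\
  exists rho eps : R, [/\ (0 < rho)%R, (0 < eps)%R &
    forall x' x v, (enorm (x' - x0) < eps)%R -> (enorm (x - x0) < eps)%R ->
      (enorm (v - v0) < eps)%R -> limiting_subdiff g x v ->
      g x <= g x0 + eps%:E ->
      g x + (dotp v (x' - x) - rho / 2 * enorm (x' - x) ^+ 2)%:E <= g x'].

Definition second_quotient g x v (t : R) d : \bar R :=
  (g (x + t *: d)%R - g x - (t * dotp v d)%:E) * ((t ^+ 2 / 2)^-1)%:E.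

(* Epi-convergence of the family [h t] to [q] as t decreases to 0, i.e. along
   every sequence of positive t_j tending to 0. *)
Definition epi_converges (h : R -> 'cV[R]_n -> \bar R) (q : 'cV[R]_n -> \bar R) :
    Prop :=
  forall t : nat -> R, (forall j, (0 < t j)%R) -> t @ \oo --> (0 : R)%R ->
  forall d,
    (forall ds : nat -> 'cV[R]_n, ds @ \oo --> d ->
       q d <= limn_einf (fun j => h (t j) (ds j))) /\
    (exists2 ds : nat -> 'cV[R]_n, ds @ \oo --> d &
       limn_esup (fun j => h (t j) (ds j)) <= q d).

(* [q] is the second-order epi-derivative d^2 g(x | v). *)
Definition twice_epi_differentiable g x v (q : 'cV[R]_n -> \bar R) : Prop :=
  [/\ limiting_subdiff g x v, proper_fun q & epi_converges (second_quotient g x v) q].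

Definition quadratic_on (S : {vspace 'cV[R]_n}) (M : 'M[R]_n) d : \bar R :=
  if d \in S then (dotp d (M *m d))%:E else +oo.

End ExtendedValued.

Section SetValued.
Context {R : realType} {n : nat}.
Implicit Types (F : 'cV[R]_n -> set 'cV[R]_n) (x w : 'cV[R]_n).

Definition single_valued_at F x : Prop := exists v, F x = [set v].

(* The value of F where F is single-valued. *)
Definition value F x : 'cV[R]_n := xget 0 (F x).

Definition semi_quotient F x (p : R * 'cV[R]_n) : 'cV[R]_n :=
  p.1^-1 *: (value F (x + p.1 *: p.2) - value F x).

Definition semidifferentiable F x : Prop :=
  (\forall y \near x, single_valued_at F y) /\
  forall w, cvg (semi_quotient F x @ filter_prod (0 : R)^'+ (nbhs w)).

Definition semiderivative F x w : 'cV[R]_n :=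
  lim (semi_quotient F x @ filter_prod (0 : R)^'+ (nbhs w)).

Definition lipschitz_semidifferentiable F xs : Prop :=
  exists (U : set 'cV[R]_n) (L : R), [/\ nbhs xs U, 0 <= L,
    forall x, U x -> single_valued_at F x /\ semidifferentiable F x &
    forall x w, U x -> enorm w = 1 ->
      enorm (semiderivative F x w - semiderivative F xs w) <= L * enorm (x - xs)].

End SetValued.

Section Splitting.
Context {R : realType} {n : nat}.
Variables (f : 'cV[R]_n -> R) (g : 'cV[R]_n -> \bar R).
Implicit Types (x z : 'cV[R]_n) (gam : R).

Definition objective x : \bar R := ((f x)%:E + g x)%E.

Definition fb_map gam x : set 'cV[R]_n := prox g gam (x - gam *: grad f x).

Definition fb_residual gam x : set 'cV[R]_n :=
  [set gam^-1 *: (x - z) | z in fb_map gam x].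

Definition fb_envelope gam x : \bar R :=
  ereal_inf (range (fun z =>
    (f x + dotp (grad f x) (z - x) + (2 * gam)^-1 * enorm (z - x) ^+ 2)%:E
    + g z)%E).

Definition standing_assumptions : Prop :=
  [/\ (forall x, differentiable f x),
      lipschitz_consts (grad f) !=set0,
      [/\ proper_fun g, lower_semicontinuous g & prox_bounded g] &
      argmin objective !=set0].

Definition critical x : Prop :=
  objective x \is a fin_num /\
  exists gam, [/\ 0 < gam, (gam%:E < prox_threshold g)%E & fb_map gam x x].

Definition assumption2 x : Prop :=
  [/\ critical x,
      \forall z \near x,
        differentiable (grad f) z /\ {for z, continuous (hess f)},
      prox_regular g x (- grad f x) &
      exists (S : {vspace 'cV[R]_n}) (M : 'M[R]_n),
        twice_epi_differentiable g x (- grad f x) (quadratic_on S M)].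

(* In a \bar R, 0^-1 is +oo, which is the convention for 1 / L_f. *)
Definition zerofpr_params (gam beta pmin sigma : R) : Prop :=
  let Lf := lipschitz_modulus (grad f) in
  [/\ 0 < gam /\ (gam%:E < Order.min (Lf%:E)^-1 (prox_threshold g))%E,
      0 < beta < 1, 0 < pmin < 1 &
      0 < sigma < gam * ((1 - gam * Lf) / 2)].

Record zerofpr (gam beta pmin sigma : R) (x xbar r d : nat -> 'cV[R]_n)
    (tau p : nat -> R) (Phi : nat -> \bar R) : Prop := Zerofpr {
  zerofpr_init : Phi 0%N = fb_envelope gam (x 0%N);
  zerofpr_xbar : forall k, fb_map gam (x k) (xbar k);
  zerofpr_r : forall k, r k = gam^-1 *: (x k - xbar k);
  zerofpr_nostop : forall k, r k != 0;
  zerofpr_tau : forall k,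
    let steps := [set t | exists2 m : nat, t = beta ^+ m &
      (fb_envelope gam (xbar k + t *: d k)%R
         <= Phi k - (sigma * enorm (r k) ^+ 2)%:E)%E] in
    steps (tau k) /\ ubound steps (tau k);
  zerofpr_x : forall k, x k.+1 = xbar k + tau k *: d k;
  zerofpr_p : forall k, pmin <= p k <= 1;
  zerofpr_Phi : forall k,
    Phi k.+1 = ((1 - p k)%:E * Phi k + (p k)%:E * fb_envelope gam (x k.+1))%E
}.

End Splitting.

Section Broyden.
Context {R : realType} {n : nat}.

(* The convention here is sign 0 = 1, unlike [Num.sg]. *)
Definition broyden_theta (thetabar gamk : R) : R :=
  if thetabar <= `|gamk| then 1
  else (1 - (if 0 <= gamk then 1 else -1) * thetabar) / (1 - gamk).

Definition broyden_update (thetabar : R) (H : 'M[R]_n) (s y : 'cV[R]_n) : 'M[R]_n :=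
  let gamk := dotp (H *m y) s / enorm s ^+ 2 in
  let theta := broyden_theta thetabar gamk in
  H + (dotp s ((theta^-1 - 1) *: s + H *m y))^-1
      *: ((s - H *m y) *m (s^T *m H)).

Record broyden_directions (Rmap : 'cV[R]_n -> set 'cV[R]_n) (thetabar : R)
    (x xbar r d rbar : nat -> 'cV[R]_n) (H : nat -> 'M[R]_n) : Prop :=
  BroydenDirections {
    broyden_thetabar : 0 < thetabar < 1;
    broyden_init : H 0%N \in unitmx;
    broyden_rbar : forall k, Rmap (xbar k) (rbar k);
    broyden_d : forall k, d k = - (H k *m rbar k);
    broyden_s : forall k, x k.+1 - xbar k != 0;
    broyden_H : forall k,
      H k.+1 = broyden_update thetabar (H k) (x k.+1 - xbar k) (r k.+1 - rbar k)
  }.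

End Broyden.

(* Main.v *)
Require Import Defs.
From mathcomp Require Import all_boot all_order all_algebra.
From mathcomp Require Import all_classical all_reals all_analysis.
From mathcomp Require Import ring lra.

Import Order.TTheory GRing.Theory Num.Theory.
Import numFieldNormedType.Exports.

Local Open Scope classical_set_scope.
Local Open Scope ring_scope.

(* The residual R_gam is analysed directly, without differentiating the envelope.

   Along xs + t w the rescaled forward-backward points minimize second-order
   difference quotients of g plus a quadratic, so by epi-convergence the
   semiderivative of T_gam at xs in direction w minimizes
   <e, M e> + |e - (I - gam Hess f) w|^2 / gam over e in S.  The stationarity
   conditions are linear and, since gam L_f < 1, have a unique solution; hence the
   semiderivative of R_gam is linear and R_gam is Frechet differentiable at xs.
   A kernel vector of the Jacobian J would contradict the quadratic growth of the
   objective, so |R_gam(x)| and |x - xs| are comparable near xs.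

   The line search makes |r^k|^2 summable, hence so are |x^k - xs|^2 and
   |xbar^k - xs|^2.  Integrating the Lipschitz semiderivative along segments gives
   |y_k - J s_k| <= L max(|x^{k+1} - xs|, |xbar^k - xs|) |s_k|.  With B_k the inverse
   of H_k, the update reads B_{k+1} = B_k + theta_k (y_k - B_k s_k) s_k^T / |s_k|^2, and
   |B_k - J|_F^2 decreases by a multiple of (|(B_k - J) s_k| / |s_k|)^2 up to a
   summable error.  Therefore this ratio tends to 0, which is the Dennis-More
   condition.  It yields |xbar^k + d^k - xs| = o(|xbar^k - xs|), and the unit step is
   accepted because the envelope exceeds phi(xs) by at most O(|x - xs|^2) at any x
   and by at least gam (1 - gam L_f) / 2 |r^k|^2 at x^k. *)

(** * Euclidean norm, its equivalence with the sup norm, and the Frobenius norm *)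

Section Euclidean.
Context {R : realType} {n : nat}.
Implicit Types (x y z : 'cV[R]_n) (a b c : R) (A : 'M[R]_n).

Lemma dotpE x y : dotp x y = \sum_i x i 0 * y i 0.
Proof. by rewrite /dotp mxE; apply: eq_bigr => i _; rewrite mxE. Qed.

Lemma dotpC x y : dotp x y = dotp y x.
Proof. by rewrite !dotpE; apply: eq_bigr => i _; rewrite mulrC. Qed.

Lemma dotpDl x y z : dotp (x + y) z = dotp x z + dotp y z.
Proof.
by rewrite !dotpE -big_split; apply: eq_bigr => i _; rewrite mxE mulrDl.
Qed.

Lemma dotpDr x y z : dotp z (x + y) = dotp z x + dotp z y.
Proof. by rewrite dotpC dotpDl !(dotpC z). Qed.

Lemma dotpZl a x y : dotp (a *: x) y = a * dotp x y.
Proof.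
by rewrite !dotpE mulr_sumr; apply: eq_bigr => i _; rewrite mxE mulrA.
Qed.

Lemma dotpZr a x y : dotp x (a *: y) = a * dotp x y.
Proof. by rewrite dotpC dotpZl dotpC. Qed.

Lemma dotpNl x y : dotp (- x) y = - dotp x y.
Proof. by rewrite -scaleN1r dotpZl mulN1r. Qed.

Lemma dotpNr x y : dotp x (- y) = - dotp x y.
Proof. by rewrite dotpC dotpNl dotpC. Qed.

Lemma dotp0l x : dotp 0 x = 0.
Proof. by rewrite -(scale0r x) dotpZl mul0r. Qed.

Lemma dotp0r x : dotp x 0 = 0.
Proof. by rewrite dotpC dotp0l. Qed.

Definition dotpE_lin :=
  (dotpDl, dotpDr, dotpNl, dotpNr, dotpZl, dotpZr, dotp0l, dotp0r).

Lemma dotp_ge0 x : 0 <= dotp x x.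
Proof. by rewrite dotpE; apply: sumr_ge0 => i _; rewrite -expr2 sqr_ge0. Qed.

Lemma dotp_eq0 x : (dotp x x == 0) = (x == 0).
Proof.
apply/eqP/eqP => [x0|->]; last by rewrite dotp0l.
apply/colP => i; rewrite mxE; apply/eqP; rewrite -(orbb (x i 0 == 0)) -mulf_eq0.
apply/eqP; move: i isT; apply: psumr_eq0P; last by rewrite -dotpE.
by move=> i _; rewrite -expr2 sqr_ge0.
Qed.

Lemma enorm_ge0 x : 0 <= enorm x.
Proof. exact: sqrtr_ge0. Qed.

Lemma enorm_sqr x : enorm x ^+ 2 = dotp x x.
Proof. by rewrite sqr_sqrtr// dotp_ge0. Qed.

Lemma enorm_eq0 x : (enorm x == 0) = (x == 0).
Proof. by rewrite -sqrf_eq0 enorm_sqr dotp_eq0. Qed.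

Lemma enorm0 : enorm (0 : 'cV[R]_n) = 0.
Proof. by apply/eqP; rewrite enorm_eq0. Qed.

Lemma enorm_gt0 x : (0 < enorm x) = (x != 0).
Proof. by rewrite lt_def enorm_eq0 enorm_ge0 andbT. Qed.

Lemma enormZ a x : enorm (a *: x) = `|a| * enorm x.
Proof.
apply/eqP; rewrite -(@eqrXn2 _ 2%N)// ?mulr_ge0 ?enorm_ge0//.
by rewrite exprMn !enorm_sqr !dotpE_lin real_normK ?num_real// mulrA expr2.
Qed.

Lemma enormN x : enorm (- x) = enorm x.
Proof. by rewrite -scaleN1r enormZ normrN1 mul1r. Qed.

Lemma enorm_distC x y : enorm (x - y) = enorm (y - x).
Proof. by rewrite -enormN opprB. Qed.

(** Cauchy-Schwarz: expand the nonnegative squared norm of [|y|^2 x - <x, y> y] and divide by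
    [|y|^2]. *)
Lemma normr_dotp_le x y : `|dotp x y| <= enorm x * enorm y.
Proof.
rewrite -(@ler_pXn2r _ 2%N)// ?nnegrE ?mulr_ge0 ?enorm_ge0//.
rewrite exprMn !enorm_sqr real_normK ?num_real//.
have [->|y0] := eqVneq y 0; first by rewrite !dotpE_lin expr0n mulr0.
have yy : 0 < dotp y y by rewrite lt_def dotp_eq0 y0 dotp_ge0.
have := dotp_ge0 (dotp y y *: x - dotp x y *: y).
rewrite !dotpE_lin (dotpC y x).
set p := dotp x y; set q := dotp y y in yy *; set s := dotp x x => h.
have : 0 <= q * (s * q - p ^+ 2) by move: h; congr (_ <= _); ring.
by rewrite pmulr_rge0// subr_ge0.
Qed.

Lemma dotp_le x y : dotp x y <= enorm x * enorm y.
Proof. exact: le_trans (ler_norm _) (normr_dotp_le x y). Qed.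

Lemma enormD x y : enorm (x + y) <= enorm x + enorm y.
Proof.
rewrite -(@ler_pXn2r _ 2%N)// ?nnegrE ?addr_ge0 ?enorm_ge0//.
rewrite sqrrD !enorm_sqr !dotpE_lin (dotpC y x) mulr2n.
by have := dotp_le x y; lra.
Qed.

Lemma enormB x y : enorm (x - y) <= enorm x + enorm y.
Proof. by rewrite -(enormN y) enormD. Qed.

Lemma enorm_triangle z x y : enorm (x - y) <= enorm (x - z) + enorm (z - y).
Proof. by rewrite (le_trans _ (enormD _ _))// addrA subrK. Qed.

Lemma mx_norm_le_enorm x : `|x| <= enorm x.
Proof.
rewrite [leLHS]mx_normrE; apply/bigmax_leP; split; first exact: enorm_ge0.
move=> [i j] _; rewrite ord1 /=.
rewrite -(@ler_pXn2r _ 2%N)// ?nnegrE ?enorm_ge0// enorm_sqr dotpE.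
rewrite real_normK ?num_real// (bigD1 i)//= -expr2 lerDl.
by apply: sumr_ge0 => k _; rewrite -expr2 sqr_ge0.
Qed.

Lemma enorm_le_mx_norm x : enorm x <= Num.sqrt n%:R * `|x|.
Proof.
rewrite -(@ler_pXn2r _ 2%N)// ?nnegrE ?mulr_ge0 ?sqrtr_ge0 ?enorm_ge0//.
rewrite enorm_sqr exprMn sqr_sqrtr ?ler0n// dotpE.
rewrite mulr_natl -[X in _ *+ X](card_ord n) -sumr_const.
apply: ler_sum => i _; rewrite -expr2 -[leLHS]real_normK ?num_real//.
rewrite ler_pXn2r// ?nnegrE// [leRHS]mx_normrE.
exact: (le_bigmax _ (fun ij => `|x ij.1 ij.2|) (i, 0)).
Qed.

(** The two norms differ by a factor of at most sqrt n, so Euclidean balls form a neighbourhood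
    basis of the sup-norm topology. *)
Lemma near_enormP x (P : set 'cV[R]_n) :
  (\forall z \near x, P z) <->
  exists2 e : R, 0 < e & forall z, enorm (z - x) < e -> P z.
Proof.
split=> [/nbhs_ballP[e e0 xeP]|[e e0 xeP]].
  exists e => // z zx; apply: xeP; rewrite -ball_normE /= distrC.
  exact: le_lt_trans (mx_norm_le_enorm _) _.
(* Adding 1 keeps the divisor positive when n = 0. *)
have s0 : 0 < Num.sqrt (n%:R : R) + 1 by rewrite ltr_wpDl// sqrtr_ge0.
apply/nbhs_ballP; exists (e / (Num.sqrt n%:R + 1)); first exact: divr_gt0.
move=> z; rewrite -ball_normE /= distrC => zx; apply: xeP.
apply: le_lt_trans (enorm_le_mx_norm _) _.
move: zx; rewrite ltr_pdivlMr// mulrC; apply: le_lt_trans.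
by rewrite ler_wpM2r// lerDl.
Qed.

Lemma cvg_enormP {T : Type} {F : set_system T} {FF : Filter F}
    (u : T -> 'cV[R]_n) x :
  (u @ F --> x) <-> ((fun k => enorm (u k - x)) @ F --> (0 : R)).
Proof.
split=> [ux|ux].
  apply/cvgrPdist_lt => e e0.
  have /ux : nbhs x [set z | enorm (z - x) < e] by apply/near_enormP; exists e.
  move=> uxe; apply: (@filterS _ _ FF _ _ _ uxe) => k /=.
  by rewrite sub0r normrN ger0_norm ?enorm_ge0.
apply/cvg_ballP => e e0; have /cvgrPdist_lt/(_ _ e0) uxe := ux.
apply: (@filterS _ _ FF _ _ _ uxe) => k /=; rewrite sub0r normrN ger0_norm ?enorm_ge0// => uke.
rewrite -ball_normE /= distrC; exact: le_lt_trans (mx_norm_le_enorm _) _.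
Qed.

Lemma cvg_enorm {T : Type} {F : set_system T} {FF : Filter F}
    (u : T -> 'cV[R]_n) x :
  u @ F --> x -> (fun k => enorm (u k)) @ F --> enorm x.
Proof.
move=> /cvg_enormP/cvgrPdist_lt ux; apply/cvgrPdist_lt => e /ux uxe.
apply: (@filterS _ _ FF _ _ _ uxe) => k /=.
rewrite sub0r normrN ger0_norm ?enorm_ge0//; apply: le_lt_trans.
rewrite ler_norml; apply/andP; split.
  by have := enormD x (u k - x); rewrite subrKC; lra.
by have := enormD (u k) (x - u k); rewrite subrKC (enorm_distC x); lra.
Qed.

Lemma cvg_enorm_sqr {T : Type} {F : set_system T} {FF : Filter F}
    (u : T -> 'cV[R]_n) x :
  u @ F --> x -> (fun k => enorm (u k) ^+ 2) @ F --> enorm x ^+ 2.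
Proof.
by move=> /cvg_enorm ux; rewrite expr2; under eq_fun do rewrite expr2; exact: cvgM.
Qed.

(** The squared Frobenius norm: its root dominates the operator norm, and a rank-one update changes
    it by an explicit quadratic expression. *)
Definition frob2 A : R := \sum_i \sum_j A i j ^+ 2.

Lemma frob2_ge0 A : 0 <= frob2 A.
Proof. by apply: sumr_ge0 => i _; apply: sumr_ge0 => j _; rewrite sqr_ge0. Qed.

Lemma enorm_mulmx_le A x : enorm (A *m x) <= Num.sqrt (frob2 A) * enorm x.
Proof.
rewrite -(@ler_pXn2r _ 2%N)// ?nnegrE ?mulr_ge0 ?sqrtr_ge0 ?enorm_ge0//.
rewrite [leLHS]enorm_sqr exprMn (sqr_sqrtr (frob2_ge0 A)) dotpE mulr_suml.
apply: ler_sum => i _; rewrite -expr2.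
have -> : (A *m x) i 0 = dotp (row i A)^T x.
  by rewrite dotpE mxE; apply: eq_bigr => j _; rewrite !mxE.
have -> : \sum_j A i j ^+ 2 = enorm (row i A)^T ^+ 2.
  by rewrite enorm_sqr dotpE; apply: eq_bigr => j _; rewrite !mxE expr2.
rewrite -exprMn -[leLHS]real_normK ?num_real//.
by rewrite ler_pXn2r ?nnegrE ?mulr_ge0 ?enorm_ge0// normr_dotp_le.
Qed.

Lemma mulmx_continuous A : continuous (mulmx A : 'cV[R]_n -> 'cV[R]_n).
Proof.
move=> v B /near_enormP[e e0 vB]; apply/near_enormP.
have k0 : 0 < Num.sqrt (frob2 A) + 1 by rewrite ltr_wpDl// sqrtr_ge0.
exists (e / (Num.sqrt (frob2 A) + 1)); first exact: divr_gt0.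
move=> z; rewrite ltr_pdivlMr// => zv; apply: vB; rewrite -mulmxBr.
apply: le_lt_trans (enorm_mulmx_le _ _) _; apply: le_lt_trans zv.
by rewrite mulrC ler_wpM2l ?enorm_ge0// lerDl.
Qed.

Lemma frob2_rank1_update A x y :
  frob2 (A + x *m y^T) =
  frob2 A + 2 * dotp (A *m y) x + enorm x ^+ 2 * enorm y ^+ 2.
Proof.
rewrite !enorm_sqr !dotpE /frob2 mulr_suml mulr_sumr -!big_split /=.
apply: eq_bigr => i _; rewrite !mxE mulr_sumr mulr_suml mulr_sumr -!big_split /=.
apply: eq_bigr => j _; rewrite !mxE big_ord_recl big_ord0 addr0 !mxE.
ring.
Qed.

End Euclidean.

(** * Taylor and mean value estimates; from Hadamard to Frechet derivatives *)

Section EuclideanCalculus.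
Context {R : realType} {n : nat}.
Implicit Types (x y w h : 'cV[R]_n) (F : 'cV[R]_n -> 'cV[R]_n).

(** For x != y the ratio |F x - F y| / |x - y| is a lower bound of the admissible constants, hence
    at most their infimum. *)
Lemma lipschitz_modulusP F : lipschitz_consts F !=set0 ->
  forall x y, enorm (F x - F y) <= lipschitz_modulus F * enorm (x - y).
Proof.
move=> [L0 FL0] x y; have [->|xy] := eqVneq x y.
  by rewrite !subrr !enorm0 mulr0.
have xy0 : 0 < enorm (x - y) by rewrite enorm_gt0 subr_eq0.
rewrite -ler_pdivrMr//; apply: lb_le_inf; first by exists L0.
by move=> L [_ FL]; rewrite ler_pdivrMr.
Qed.

Lemma lipschitz_modulus_ge0 F : lipschitz_consts F !=set0 ->
  0 <= lipschitz_modulus F.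
Proof. by move=> F0; apply: lb_le_inf => // L []. Qed.

Lemma col_sum_delta (v : 'cV[R]_n) : v = \sum_i v i 0 *: delta_mx i 0.
Proof.
apply/colP => i; rewrite summxE (bigD1 i)//= !mxE !eqxx mulr1.
rewrite big1 ?addr0// => j ji; rewrite !mxE eq_sym (negPf ji) mulr0//.
Qed.

Lemma dotp_grad (f : 'cV[R]_n -> R) x h :
  differentiable f x -> dotp (grad f x) h = 'D_h f x.
Proof.
move=> df; rewrite deriveE// [in RHS](col_sum_delta h) linear_sum dotpE.
by apply: eq_bigr => i _; rewrite linearZ /= -deriveE// mxE mulrC.
Qed.

Lemma jac_mulmx F x h : differentiable F x -> jac F x *m h = 'd F x h.
Proof.
move=> dF; rewrite [in RHS](col_sum_delta h) linear_sum.
apply/colP => i; rewrite mxE summxE; apply: eq_bigr => j _.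
by rewrite linearZ /= -deriveE// !mxE mulrC.
Qed.

Lemma is_derive_line (f : 'cV[R]_n -> R) x h (s : R) :
  (forall y, differentiable f y) ->
  is_derive s 1 (fun t => f (x + t *: h)) (dotp (grad f (x + s *: h)) h).
Proof.
move=> df; rewrite dotp_grad//.
have fE : (fun t : R => t^-1 *: (((fun t => f (x + t *: h)) \o shift s) (t *: 1)
             - f (x + s *: h)))
   = (fun t => t^-1 *: ((f \o shift (x + s *: h)) (t *: h) - f (x + s *: h))).
  apply/funext => t /=; congr (_ *: (f _ - _)).
  by rewrite [t *: 1]mulr1 scalerDl addrCA.
by split; rewrite /derivable /derive fE//; exact: diff_derivable.
Qed.

(** The mean value theorem is applied to f along the segment minus [a s + K/2 s^2], whose derivative
    is nonpositive on [0, 1] by assumption. The choice of [K] yields both the descent inequality and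
    the second-order upper bound. *)
Lemma taylor1_le (f : 'cV[R]_n -> R) x h (K : R) :
  (forall y, differentiable f y) ->
  (forall s, 0 <= s <= 1 ->
     dotp (grad f (x + s *: h) - grad f x) h <= K * s) ->
  f (x + h) <= f x + dotp (grad f x) h + K / 2.
Proof.
move=> df fK.
pose a := dotp (grad f x) h.
pose phi := fun s : R => f (x + s *: h) - (a * s + K / 2 * s ^+ 2).
pose dphi := fun s : R => dotp (grad f (x + s *: h)) h - (a + K * s).
have phi_d (s : R) : is_derive s (1 : R) phi (dphi s).
  have ? := @is_derive_line f x h s df.
  have -> : phi = (fun t : R => f (x + t *: h)) - (a *: id + (K / 2) *: (id * id)).
    by apply/funext => t; rewrite /phi !fctE /GRing.scale /= expr2.
  have ds : is_derive s (1 : R) id 1 := is_derive_id s (1 : R).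
  have ds2 : is_derive s (1 : R) (id * id : R -> R) (s + s).
    have := @is_deriveM R _ id id s 1 1 1 ds ds.
    by rewrite /GRing.scale /= !mulr1.
  have ? : is_derive s (1 : R) (a *: id + (K / 2) *: (id * id)) (a + K * s).
    have := is_deriveD (is_deriveZ a ds) (is_deriveZ (K / 2) ds2).
    by congr is_derive; rewrite /GRing.scale /=; field.
  exact: is_deriveB.
have [c cI phi01] : exists2 c, c \in `[(0 : R), 1]%R & phi 1 - phi 0 = dphi c * (1 - 0).
  apply: MVT_segment; first exact: ler01.
  apply/continuous_in_subspaceT => t _.
  by apply/differentiable_continuous/derivable1_diffP; apply: ex_derive.
have : phi 1 - phi 0 <= 0.
  rewrite phi01 subr0 mulr1 /dphi.
  by have := fK c cI; rewrite dotpDl dotpNl -/a; lra.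
by rewrite /phi -/a scale1r scale0r addr0 expr0n expr1n /=; lra.
Qed.

(* Leftward continuity and a bound on the right difference quotients suffice: the
   supremum of the times at which the estimate holds is attained by the former
   and can be passed by the latter. *)
Lemma right_mean_value_le (G : R -> 'cV[R]_n) (K l : R) : 0 <= l ->
  (forall t e, 0 <= t < l -> 0 < e ->
    \forall h \near 0^'+, enorm (G (t + h) - G t) <= (K + e) * h) ->
  (forall t e, 0 < t <= l -> 0 < e ->
    \forall h \near 0^'+, enorm (G (t - h) - G t) <= e) ->
  enorm (G l - G 0) <= K * l.
Proof.
move=> l0 Gr Gl; rewrite le_eqVlt in l0; case/predU1P: l0 => [<-|l0].
  by rewrite subrr enorm0 mulr0.
apply/ler_addgt0Pr => e' e'0.
pose e := e' / l; have e0 : 0 < e by exact: divr_gt0.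
have -> : K * l + e' = (K + e) * l by rewrite mulrDl /e divfK// gt_eqF.
pose A := [set t | 0 <= t <= l /\ enorm (G t - G 0) <= (K + e) * t].
have A0 : A 0 by rewrite /A /= lexx ltW// subrr enorm0 mulr0.
have ubA : ubound A l by move=> t [/andP[]].
have supA : has_sup A by split; [exists 0|exists l].
set s := sup A.
have s0 : 0 <= s by apply: ub_le_sup => //; exists l.
have sl : s <= l by apply: ge_sup => //; exists 0.
have As : A s.
  split; first exact/andP.
  move: s0; rewrite le_eqVlt => /predU1P[<-|s0]; first by case: A0.
  apply/ler_addgt0Pr => c c0.
  have [d /= d0 sd] : \forall h \near 0^'+, enorm (G (s - h) - G s) <= c / 2.
    by apply: Gl; [apply/andP|apply: divr_gt0].
  (* An element [t] of [A] within [eta] of [s] loses at most c / 2 through leftward continuity and c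
     / 2 through the slope [K + e]. *)
  pose k := `|K + e| + 1; have k0 : 0 < k by rewrite ltr_wpDl.
  pose eta := Num.min d (c / 2 / k).
  have eta0 : 0 < eta by rewrite lt_min d0 !divr_gt0.
  have [t [At1 At2] st] := sup_adherent eta0 supA.
  have ts : t <= s by apply: ub_le_sup => //; exists l.
  rewrite -/s in st.
  have [->//|tns] := eqVneq s t; first by lra.
  have {}ts : t < s by rewrite lt_def tns.
  have st_d : s - t < d.
    by have : eta <= d; [rewrite ge_min lexx|lra].
  have st_c : (s - t) * k <= c / 2.
    rewrite -ler_pdivlMr//; have : eta <= c / 2 / k by rewrite ge_min lexx orbT.
    by lra.
  have Gt : enorm (G t - G s) <= c / 2.
    rewrite -[t](subKr s); apply: sd => /=; last by rewrite subr_gt0.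
    by rewrite sub0r normrN gtr0_norm// subr_gt0.
  have := enorm_triangle (G t) (G s) (G 0); rewrite (enorm_distC (G s) (G t)).
  have : `|(K + e) * (s - t)| <= (s - t) * k.
    rewrite normrM mulrC (gtr0_norm (x := s - t)) ?subr_gt0//.
    by rewrite ler_pM2l ?subr_gt0// /k; lra.
  by rewrite ler_norml => /andP[]; lra.
suff -> : l = s by case: As.
apply/eqP; rewrite eq_le sl andbT leNgt; apply/negP => {}sl.
have [d /= d0 sd] : \forall h \near 0^'+, enorm (G (s + h) - G s) <= (K + e) * h.
  by apply: Gr => //; rewrite s0.
pose h := Num.min (d / 2) (l - s).
have h0 : 0 < h by rewrite lt_min divr_gt0//= subr_gt0.
have : A (s + h).
  split.
    rewrite addr_ge0 ?(ltW h0)//=.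
    have : h <= l - s by rewrite ge_min lexx orbT.
    by lra.
  have Gh : enorm (G (s + h) - G s) <= (K + e) * h.
    apply: sd => //=; rewrite sub0r normrN gtr0_norm//.
    have : h <= d / 2 by rewrite ge_min lexx.
    by lra.
  by have := enorm_triangle (G s) (G (s + h)) (G 0); case: As => _; lra.
move=> /(ub_le_sup (ex_intro _ l ubA)); rewrite -/s; lra.
Qed.

Definition diff_quotient F x (p : R * 'cV[R]_n) : 'cV[R]_n :=
  p.1^-1 *: (F (x + p.1 *: p.2) - F x).

Lemma trmx_continuous : continuous (@trmx R 1 n).
Proof.
move=> v B /nbhs_ballP[e /= e0 eB]; apply/nbhs_ballP; exists e => // w.
rewrite -ball_normE /= => vw; apply: eB; rewrite -ball_normE /= -raddfB.
apply: le_lt_trans vw.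
rewrite [leLHS]mx_normrE; apply/bigmax_leP; split => // -[i j] _; rewrite mxE.
rewrite [leRHS]mx_normrE.
exact: (le_bigmax _ (fun ij => `|(v - w) ij.1 ij.2|) (j, i)).
Qed.

(* A Hadamard derivative is uniform on the compact box [-1, 1]^n, which contains
   the unit sphere. *)
Lemma hadamard_frechet F x (A : 'M[R]_n) :
  (forall w, diff_quotient F x @ filter_prod (0 : R)^'+ (nbhs w) --> A *m w) ->
  forall e, 0 < e ->
    \forall z \near x, enorm (F z - F x - A *m (z - x)) <= e * enorm (z - x).
Proof.
move=> dF e e0.
pose I1 : set R := `[-1, 1]%classic.
pose box := [set v : 'rV[R]_n | forall i, I1 (v ord0 i)].
have boxK : compact box.
  by apply: (@rV_compact R n (fun=> I1)) => i; exact: segment_compact.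
pose P (t : R) (v : 'rV[R]_n) := enorm (diff_quotient F x (t, v^T) - A *m v^T) <= e.
have : \forall t \near 0^'+, box `<=` P t.
  (* Compactness in its covering form makes the joint limit in (t, w) uniform in w: a single
     threshold for t serves the whole box. *)
  move/compact_near_coveringP : boxK; apply => v _.
  have q0 : (fun p => diff_quotient F x p - A *m p.2) @
      filter_prod (0 : R)^'+ (nbhs v^T) --> A *m v^T - A *m v^T.
    apply: cvgB; first exact: dF.
    by apply: (cvg_comp snd (mulmx A) (@cvg_snd _ _ _ _ _)); exact: mulmx_continuous.
  have /cvgrPdist_le /(_ _ e0) : (fun p => enorm (diff_quotient F x p - A *m p.2)) @
      filter_prod (0 : R)^'+ (nbhs v^T) --> (0 : R).
    by have := cvg_enorm _ _ q0; rewrite subrr enorm0; apply.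
  move=> [[B1 B2] /= [B10 B2v] Be].
  exists ([set w | B2 w^T], B1); first by split => //; exact: trmx_continuous.
  move=> [w t] /= [Bw Bt].
  have := Be (t, w^T) (conj Bt Bw).
  by rewrite /P sub0r normrN ger0_norm ?enorm_ge0.
move=> [d /= d0 dP]; apply/near_enormP; exists d => // z zx.
have [->|zx0] := eqVneq z x.
  by rewrite !subrr mulmx0 subrr enorm0 mulr0.
have t0 : 0 < enorm (z - x) by rewrite enorm_gt0 subr_eq0.
set t := enorm (z - x) in zx t0 *.
pose w := t^-1 *: (z - x).
have zE : z = x + t *: w by rewrite scalerA divff ?gt_eqF// scale1r subrKC.
have : P t w^T.
  apply: (dP t) => //=; first by rewrite sub0r normrN gtr0_norm.
  move=> i; rewrite mxE /I1 /= in_itv /= -ler_norml.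
  have w1 : enorm w = 1.
    by rewrite enormZ gtr0_norm ?invr_gt0// mulVf// gt_eqF.
  rewrite -w1; apply: le_trans (mx_norm_le_enorm _); rewrite [leRHS]mx_normrE.
  exact: (le_bigmax _ (fun ij => `|w ij.1 ij.2|) (i, 0)).
rewrite /P /diff_quotient /= trmxK -zE.
have -> : A *m w = t^-1 *: (A *m (z - x)) by rewrite -scalemxAr.
rewrite -scalerBr enormZ gtr0_norm ?invr_gt0// mulrC ler_pdivrMr//.
Qed.

(** Dividing e by sqrt n + 1 turns the Euclidean remainder bound into a sup-norm little-o;
    uniqueness of the differential then identifies the Jacobian. *)
Lemma frechet_differentiable F x (A : 'M[R]_n) :
  (forall e, 0 < e ->
    \forall z \near x, enorm (F z - F x - A *m (z - x)) <= e * enorm (z - x)) ->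
  differentiable F x /\ jac F x = A.
Proof.
move=> dF.
pose L : {linear 'cV[R]_n -> 'cV[R]_n} := mulmx A.
have Lc : continuous L := mulmx_continuous A.
have FL e : 0 < e -> \forall h \near (0 : 'cV[R]_n),
    `|F (h + x) - (F x + A *m h)| <= e * `|h|.
  move=> e0.
  have s0 : 0 < Num.sqrt (n%:R : R) + 1 by rewrite ltr_wpDl// sqrtr_ge0.
  have /near_enormP[d d0 dP] := dF _ (divr_gt0 e0 s0).
  apply/near_enormP; exists d => // h; rewrite subr0 => hd.
  have := dP (h + x); rewrite addrK => /(_ hd) hF.
  apply: le_trans (mx_norm_le_enorm _) _; rewrite opprD addrA.
  apply: le_trans hF _; rewrite mulrAC ler_pdivrMr// -mulrA ler_pM2l// mulrC.
  apply: le_trans (enorm_le_mx_norm _) _.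
  by rewrite ler_wpM2r// lerDl.
have dL : 'd F x = L :> (_ -> _).
  by apply: diff_unique => //; apply/eqaddoP => e; exact: FL.
have dfF : differentiable F x.
  by apply/diff_locallyP; rewrite dL; split => //; apply/eqaddoP => e; exact: FL.
split => //; apply/matrixP => i j.
rewrite mxE deriveE// dL /= mxE (bigD1 j)//= !mxE !eqxx mulr1 big1 ?addr0// => k kj.
by rewrite !mxE (negPf kj) mulr0.
Qed.

End EuclideanCalculus.

(** * Eventual bounds from upper and lower limits of extended-real sequences *)

Section LimInfSup.
Context {R : realType}.
Implicit Types (u : nat -> \bar R) (c e : R).
Local Open Scope ereal_scope.

Lemma limn_esup_near_lt u c e : limn_esup u <= c%:E -> (0 < e)%R ->
  \forall j \near \oo, u j < (c + e)%:E.
Proof.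
move=> uc e0.
have : limn_esup u < (c + e)%:E by rewrite (le_lt_trans uc)// lte_fin ltrDl.
rewrite /limn_esup limf_esupE => /ereal_inf_lt[_ [V Voo <-] Vc].
apply: filterS Voo => j Vj; apply: le_lt_trans Vc.
by apply: ereal_sup_ubound; exists j.
Qed.

Lemma limn_einf_near_le u (q c : \bar R) : q <= limn_einf u ->
  (\forall j \near \oo, u j <= c) -> q <= c.
Proof.
move=> qu uc; apply: le_trans qu _.
rewrite -[limn_einf u]/(limf_einf u \oo) limf_einfE.
apply: ge_ereal_sup => _ [V Voo <-].
have [j [Vj ujc]] := filter_ex (filterI Voo uc).
by apply: le_trans ujc; apply: ereal_inf_lbound; exists j.
Qed.

End LimInfSup.

(** * First-order estimates and norm bounds for Jacobians and matrices *)

Section FrechetEstimates.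
Context {R : realType} {n : nat}.
Implicit Types (x y w h : 'cV[R]_n) (F : 'cV[R]_n -> 'cV[R]_n).

Lemma differentiable_frechet F x : differentiable F x ->
  forall e, 0 < e ->
  \forall z \near x, enorm (F z - F x - jac F x *m (z - x)) <= e * enorm (z - x).
Proof.
move=> dF e e0; have /diff_locally/eqaddoP := dF.
have s0 : 0 < Num.sqrt (n%:R : R) + 1 by rewrite ltr_wpDl// sqrtr_ge0.
move=> /(_ _ (divr_gt0 e0 s0))/near_enormP[d d0 dP].
apply/near_enormP; exists d => // z zx.
have := dP (z - x); rewrite subr0 => /(_ zx); rewrite !fctE /= subrK opprD addrA.
rewrite -jac_mulmx// => zF.
apply: le_trans (enorm_le_mx_norm _) _.
have zn := mx_norm_le_enorm (z - x).
have m0 := normr_ge0 (F z - F x - jac F x *m (z - x)).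
apply: (@le_trans _ _ ((Num.sqrt n%:R + 1) * `|F z - F x - jac F x *m (z - x)|)).
  by rewrite ler_wpM2r// lerDl.
rewrite mulrC -ler_pdivlMr//; apply: le_trans zF _.
by rewrite mulrAC ler_pM2r ?invr_gt0// ler_pM2l.
Qed.

Lemma near_line x w (P : set 'cV[R]_n) : (\forall z \near x, P z) ->
  \forall t \near 0^'+, P (x + t *: w).
Proof.
move=> /near_enormP[d d0 dP].
have k0 : 0 < enorm w + 1 by rewrite ltr_wpDl// enorm_ge0.
exists (d / (enorm w + 1)) => /=; first exact: divr_gt0.
move=> t /= + t0; rewrite sub0r normrN gtr0_norm// ltr_pdivlMr// => td.
apply: dP; rewrite addrAC subrr add0r enormZ gtr0_norm//; nra.
Qed.

Lemma differentiable_line_quotient F x w : differentiable F x ->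
  (fun t : R => t^-1 *: (F (x + t *: w) - F x)) @ (0 : R)^'+ --> jac F x *m w.
Proof.
move=> /differentiable_frechet dF; apply/cvg_enormP/cvgrPdist_le => e e0.
have k0 : 0 < enorm w + 1 by rewrite ltr_wpDl// enorm_ge0.
have := near_line x w _ (dF _ (divr_gt0 e0 k0)).
apply: filter_app; near=> t.
have t0 : 0 < t by near: t; exact: nbhs_right_gt.
rewrite (addrAC x) subrr add0r -scalemxAr => Ft.
rewrite sub0r normrN ger0_norm ?enorm_ge0//.
have -> : jac F x *m w = t^-1 *: (t *: (jac F x *m w)).
  by rewrite scalerA mulVf ?scale1r ?gt_eqF.
rewrite -scalerBr enormZ gtr0_norm ?invr_gt0// mulrC ler_pdivrMr//.
apply: le_trans Ft _; rewrite enormZ gtr0_norm// mulrAC ler_pdivrMr//.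
have := enorm_ge0 w; nra.
Unshelve. all: by end_near. Qed.

(** Difference quotients along a line are bounded by L |h|, and the bound passes to the limit. *)
Lemma enorm_jac_le F x (L : R) : differentiable F x ->
  (forall y z, enorm (F y - F z) <= L * enorm (y - z)) ->
  forall h, enorm (jac F x *m h) <= L * enorm h.
Proof.
move=> dF FL h.
apply: (cvgr_to_le (cvg_enorm _ _ (differentiable_line_quotient F x h dF))).
near=> t.
have t0 : 0 < t by near: t; exact: nbhs_right_gt.
rewrite enormZ gtr0_norm ?invr_gt0// mulrC ler_pdivrMr//.
apply: le_trans (FL _ _) _.
by rewrite (addrAC x) subrr add0r enormZ gtr0_norm// (mulrC t) mulrA.
Unshelve. all: by end_near. Qed.

Lemma linear_matrix F : (forall a u v, F (a *: u + v) = a *: F u + F v) ->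
  exists A : 'M[R]_n, forall w, F w = A *m w.
Proof.
move=> Flin.
have F0 : F 0 = 0.
  by have := Flin 1 0 0; rewrite !scale1r addr0 -[LHS]addr0 => /addrI.
exists (\matrix_(i, j) F (delta_mx j 0) i 0) => w; rewrite [in LHS](col_sum_delta w).
have -> : F (\sum_i w i 0 *: delta_mx i 0) = \sum_i w i 0 *: F (delta_mx i 0).
  by elim/big_rec2: _ => // i u v _ <-; rewrite Flin.
apply/colP => i; rewrite mxE summxE; apply: eq_bigr => j _.
by rewrite !mxE mulrC.
Qed.

(** An injective square matrix is invertible; the constant is the reciprocal of a bound on the norm
    of its inverse. *)
Lemma injective_mulmx_lower_bound (A : 'M[R]_n) :
  (forall w, A *m w = 0 -> w = 0) ->
  exists2 c : R, 0 < c & forall w, c * enorm w <= enorm (A *m w).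
Proof.
move=> Ainj; have Au : A \in unitmx.
  rewrite -unitmx_tr -row_free_unit -kermx_eq0; apply/eqP/row_matrixP => i.
  rewrite row0; apply: trmx_inj; rewrite trmx0; apply: Ainj.
  by apply: trmx_inj; rewrite trmx_mul trmxK trmx0 -row_mul mulmx_ker row0.
have k0 : 0 < Num.sqrt (frob2 (invmx A)) + 1 by rewrite ltr_wpDl// sqrtr_ge0.
exists (Num.sqrt (frob2 (invmx A)) + 1)^-1 => [|w]; first by rewrite invr_gt0.
rewrite mulrC ler_pdivrMr//; have := enorm_mulmx_le (invmx A) (A *m w).
rewrite mulKmx// => h; apply: le_trans h _.
by rewrite mulrC ler_wpM2l ?enorm_ge0// lerDl.
Qed.

End FrechetEstimates.

(** * One Broyden step: the update of the inverse and its bounded deterioration *)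

Section BroydenUpdate.
Context {R : realType} {n : nat}.
Implicit Types (s y u : 'cV[R]_n) (A B J : 'M[R]_n) (tb : R).

(** The expression [1 - th * (1 - gk)] equals [gk] without damping, where |gk| >= tb, and [tb] or
    [- tb] with damping. It is the critical factor of the denominator in the update. *)
Lemma broyden_theta_bounds tb (gk : R) : 0 < tb < 1 ->
  let th := broyden_theta tb gk in
  [/\ 1 - tb <= th <= 1 + tb & 1 - th * (1 - gk) != 0].
Proof.
move=> /andP[tb0 tb1] /=; rewrite /broyden_theta.
have [tg|tg] := leP tb `|gk|.
  split; first by apply/andP; split; lra.
  by rewrite mul1r subKr; apply/eqP => g0; move: tg; rewrite g0 normr0; lra.
have : gk < 1 by apply: le_lt_trans (ler_norm _) _; lra.
rewrite -subr_gt0 => g1.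
have g1N : 1 - gk != 0 by rewrite gt_eqF.
rewrite divfK//; have [gk0|gk0] := leP 0 gk.
  rewrite ger0_norm// in tg; rewrite mul1r subKr gt_eqF//; split => //.
  by apply/andP; rewrite ler_pdivrMr// ler_pdivlMr//; split; nra.
rewrite ltr0_norm// in tg; rewrite mulN1r subKr oppr_eq0 gt_eqF//; split => //.
by apply/andP; rewrite ler_pdivrMr// ler_pdivlMr//; split; nra.
Qed.

Lemma mulmx_dotp (p q : nat) (u : 'M[R]_(p, 1)) s y (v : 'M[R]_(1, q)) :
  u *m s^T *m (y *m v) = dotp s y *: (u *m v).
Proof.
rewrite mulmxA -(mulmxA u) /dotp.
by rewrite [s^T *m y]mx11_scalar mul_mx_scalar scalemxAl !mxE.
Qed.

(* Sherman-Morrison *)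
Lemma broyden_update_inverse tb A B s y : 0 < tb < 1 -> s != 0 -> A *m B = 1%:M ->
  exists2 th : R, 1 - tb <= th <= 1 + tb &
    broyden_update tb A s y *m
      (B + ((th / enorm s ^+ 2) *: (y - B *m s)) *m s^T) = 1%:M.
Proof.
move=> tb01 s0 AB; pose gk := dotp (A *m y) s / enorm s ^+ 2.
have [thb th0] := broyden_theta_bounds tb gk tb01.
rewrite /broyden_update -/gk; set th := broyden_theta tb gk in thb th0 *.
exists th => //.
have th_gt0 : 0 < th by lra.
set e2 := enorm s ^+ 2; have e0 : e2 != 0 by rewrite sqrf_eq0 enorm_eq0.
set v := A *m y.
set den := dotp s _.
have denE : den = e2 * (th^-1 - 1) + dotp s v.
  by rewrite /den !dotpE_lin -enorm_sqr mulrC.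
have gE : dotp s v = gk * e2 by rewrite /gk divfK// dotpC.
(* The denominator is |s|^2 / th times the factor that [broyden_theta_bounds] shows to be
   nonzero. *)
have den0 : den != 0.
  rewrite denE gE.
  have -> : e2 * (th^-1 - 1) + gk * e2 = e2 / th * (1 - th * (1 - gk)).
    by field; rewrite gt_eqF.
  exact: (mulf_neq0 (mulf_neq0 e0 (invr_neq0 (lt0r_neq0 th_gt0))) th0).
(* The product is the identity plus three multiples of (s - v) s^T, whose coefficients cancel. *)
rewrite -scalemxAl mulmxDl !mulmxDr AB -!addrA -[RHS]addr0; congr (_ + _).
have -> : A *m ((th / e2) *: ((y - B *m s) *m s^T)) = (th / e2) *: ((v - s) *m s^T).
  by rewrite -scalemxAr mulmxA mulmxBr mulmxA AB mul1mx.
have -> : (den^-1 *: ((s - v) *m (s^T *m A))) *m B = den^-1 *: ((s - v) *m s^T).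
  by rewrite -scalemxAl -!mulmxA AB mulmx1.
have -> : (den^-1 *: ((s - v) *m (s^T *m A))) *m ((th / e2) *: ((y - B *m s) *m s^T))
    = (den^-1 * (th / e2) * dotp s (v - s)) *: ((s - v) *m s^T).
  rewrite -scalemxAl -scalemxAr scalerA -[in RHS]scalerA; congr (_ *: _).
  rewrite -mulmx_dotp -!mulmxA; congr (_ *m (_ *m _)).
  by rewrite !mulmxA mulmxBr mulmxA AB mul1mx.
rewrite -(opprB s v) mulNmx scalerN -scaleNr -!scalerDl.
rewrite [X in X *: _](_ : _ = 0) ?scale0r//.
rewrite !dotpE_lin -enorm_sqr -/e2 gE denE gE; field.
rewrite e0 gt_eqF//=; move: den0; rewrite denE gE => /eqP d0.
apply/eqP => h; apply: d0.
have -> : e2 * (th^-1 - 1) + gk * e2 = (e2 * (1 - th) + gk * e2 * th) / th.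
  by field; rewrite gt_eqF.
by rewrite -[RHS](mul0r th^-1); congr (_ / _); rewrite -h; ring.
Qed.

(* The update moves each row of [B - J] along s only, so the square of the
   Frobenius norm expands exactly; the cross term is absorbed by the decrease. *)
Lemma broyden_deterioration tb (th : R) B J s y : 0 < tb < 1 -> s != 0 ->
  1 - tb <= th <= 1 + tb ->
  let k := 1 - tb ^+ 2 in
  frob2 (B + ((th / enorm s ^+ 2) *: (y - B *m s)) *m s^T - J) +
    k / 2 * (enorm ((B - J) *m s) / enorm s) ^+ 2 <=
  frob2 (B - J) + (4 + 8 / k) * (enorm (y - J *m s) / enorm s) ^+ 2.
Proof.
case/andP=> tb0 tb1 s0 /andP[th1 th2]; rewrite [X in is_true X]/=.
set k := 1 - tb ^+ 2; set e := enorm s.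
have e0 : 0 < e by rewrite enorm_gt0.
set E := B - J; set z := y - J *m s.
have -> : B + ((th / e ^+ 2) *: (y - B *m s)) *m s^T - J
    = E + ((th / e ^+ 2) *: (z - E *m s)) *m s^T.
  rewrite addrAC -/E; congr (_ + (_ *: _) *m _).
  by rewrite /z /E mulmxBl opprB addrA subrK.
move: E z => E z.
rewrite frob2_rank1_update -/e enormZ !dotpE_lin.
set b := enorm (E *m s); set d := enorm z; set q := dotp (E *m s) z.
rewrite exprMn !real_normK ?num_real//.
have -> : enorm (z - E *m s) ^+ 2 = d ^+ 2 - 2 * q + b ^+ 2.
  by rewrite enorm_sqr !dotpE_lin (dotpC z (E *m s)) -/q /d /b !enorm_sqr; ring.
rewrite -(enorm_sqr (E *m s)) -/b.
have qbd : `|q| <= b * d := normr_dotp_le _ _.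
have b0 : 0 <= b := enorm_ge0 _; have d0 : 0 <= d := enorm_ge0 _.
have k0 : 0 < k by rewrite /k; nra.
(* That is, (1 - th)^2 <= tb^2, or equivalently th (2 - th) >= k. *)
have t0 : 0 <= (tb - (1 - th)) * (tb + (1 - th)) by apply: mulr_ge0; lra.
set b' := b / e; set d' := d / e.
have bE : b = b' * e by rewrite /b' divfK// gt_eqF.
have dE : d = d' * e by rewrite /d' divfK// gt_eqF.
pose q' := q / e ^+ 2.
have qE : q = q' * e ^+ 2 by rewrite /q' divfK// expf_neq0// gt_eqF.
rewrite bE dE qE.
have -> : frob2 E + 2 * (th / e ^+ 2 * (q' * e ^+ 2 - (b' * e) ^+ 2)) +
   (th / e ^+ 2) ^+ 2 * ((d' * e) ^+ 2 - 2 * (q' * e ^+ 2) + (b' * e) ^+ 2) * e ^+ 2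
   = frob2 E - th * (2 - th) * b' ^+ 2 + 2 * th * (1 - th) * q' + th ^+ 2 * d' ^+ 2.
  by field; rewrite gt_eqF.
have q'bd : `|q'| <= b' * d'.
  rewrite /q' normrM normrV ?unitfE ?expf_neq0 ?gt_eqF// (gtr0_norm (exprn_gt0 _ e0)).
  rewrite ler_pdivrMr ?exprn_gt0//; apply: le_trans qbd _.
  by rewrite le_eqVlt; apply/orP; left; apply/eqP; rewrite bE dE; ring.
have thb : k * b' ^+ 2 <= th * (2 - th) * b' ^+ 2.
  by apply: ler_wpM2r; [exact: sqr_ge0|rewrite /k; nra].
have dd : th ^+ 2 * d' ^+ 2 <= 4 * d' ^+ 2.
  by apply: ler_wpM2r; [exact: sqr_ge0|nra].
(* AM-GM: 2 (2 b d) <= (k / 2) b^2 + (8 / k) d^2 *)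
have cross : 2 * th * (1 - th) * q' <= k / 2 * b' ^+ 2 + 8 / k * d' ^+ 2.
  have c1 : `|2 * th * (1 - th)| <= 4.
    by rewrite ler_norml; apply/andP; split; nra.
  apply: le_trans (ler_norm _) _; rewrite normrM.
  apply: (@le_trans _ _ (4 * (b' * d'))); first exact: ler_pM.
  rewrite -subr_ge0.
  have -> : k / 2 * b' ^+ 2 + 8 / k * d' ^+ 2 - 4 * (b' * d')
    = (k * b' - 4 * d') ^+ 2 / (2 * k) by field; rewrite gt_eqF.
  by rewrite divr_ge0 ?sqr_ge0// mulr_ge0// ltW.
by rewrite mulrDl; lra.
Qed.

End BroydenUpdate.

(** Telescoping bounds the partial sums of [b] from [K] on by [a K + C]; a series of nonnegative
    terms with bounded partial sums converges, so its terms vanish. *)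
Lemma quasi_decrease_cvg0 {R : realType} (a b eta : nat -> R) (C : R) (K : nat) :
  (forall k, 0 <= a k) -> (forall k, 0 <= b k) ->
  (forall N, \sum_(K <= k < N) eta k <= C) ->
  (forall k, (K <= k)%N -> a k.+1 + b k <= a k + eta k) ->
  b @ \oo --> 0.
Proof.
move=> a0 b0 etaC dec.
have bS N : (K <= N)%N -> a N + \sum_(K <= k < N) b k <= a K + \sum_(K <= k < N) eta k.
  elim: N => [|N IH]; first by rewrite leqn0 => /eqP->; rewrite !big_geq.
  rewrite leq_eqVlt => /predU1P[<-|KN]; first by rewrite !big_geq.
  rewrite !big_nat_recr//=; have := IH KN; have := dec N KN; lra.
have cB : cvgn (series (fun k => b (k + K)%N)).
  apply: nondecreasing_is_cvgn.
    by apply: nondecreasing_series => k _ _; exact: b0.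
  exists (a K + C) => _ [N _ <-].
  have := bS (N + K)%N (leq_addl _ _); have := etaC (N + K)%N; have := a0 (N + K)%N.
  have -> : \sum_(K <= k < N + K) b k = series (fun k => b (k + K)%N) N.
    by rewrite -[X in index_iota X _]add0n big_addn addnK.
  lra.
have := cvg_series_cvg_0 cB.
by rewrite (cvg_shiftn K).
Qed.

(** * Epi-limits of second-order quotients and the minimization problems they satisfy *)

Section SecondOrderQuotients.
Context {R : realType} {n : nat}.
Implicit Types (g : 'cV[R]_n -> \bar R) (x v w d e h D W : 'cV[R]_n) (t gam c : R).

Lemma second_quotient_le g x v t d c : 0 < t -> g x \is a fin_num ->
  (second_quotient g x v t d <= c%:E)%E =
  (g (x + t *: d)%R <= g x + (t * dotp v d + c * (t ^+ 2 / 2))%:E)%E.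
Proof.
move=> t0 gx; have t20 : 0 < t ^+ 2 / 2 by rewrite divr_gt0// exprn_gt0.
rewrite /second_quotient lee_pdivrMr// leeBlDr// leeBlDr//.
by rewrite -EFinM -EFinD addrC [(_ * dotp _ _ + _)%R]addrC addeC.
Qed.

(** The prox point is compared with the competitor [x + t *: e]. The shift [gam *: v] of the centre
    cancels the terms linear in t, and the rest scales as t^2 / 2. *)
Lemma prox_second_quotient g gam x v t d e w c : 0 < gam -> 0 < t ->
  g x \is a fin_num ->
  prox g gam (x + gam *: v + t *: w) (x + t *: d) ->
  (second_quotient g x v t e <= c%:E)%E ->
  (second_quotient g x v t d <=
    (c + gam^-1 * (enorm (e - w) ^+ 2 - enorm (d - w) ^+ 2))%:E)%E.
Proof.
move=> gam0 t0 gx /(_ (x + t *: e)); rewrite !second_quotient_le// => px ge.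
set y := (_ + t *: w) in px.
have {px ge} : (g (x + t *: d)%R + ((2 * gam)^-1 * enorm (x + t *: d - y) ^+ 2)%:E <=
    g x + (t * dotp v e + c * (t ^+ 2 / 2))%:E +
    ((2 * gam)^-1 * enorm (x + t *: e - y) ^+ 2)%:E)%E.
  by apply: le_trans px _; rewrite leeD2r.
rewrite -leeBrDr// => /le_trans; apply; rewrite -addeA -EFinD -addeA -EFinD.
have yE z : x + z - y = z - (gam *: v + t *: w).
  by rewrite /y -(addrA x (gam *: v)) opprD addrACA subrr add0r.
rewrite leeD2l// lee_fin !yE !enorm_sqr !dotpE_lin.
rewrite (dotpC w v) (dotpC d v) (dotpC d w) (dotpC e v) (dotpC e w).
by rewrite le_eqVlt; apply/orP; left; apply/eqP; field; rewrite gt_eqF.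
Qed.

(** A recovery sequence of [e] competes with the prox points, and the lower epi-limit bounds [q D].
    Hence [D] minimizes q + |. - W|^2 / gam. *)
Lemma twice_epi_prox_limit g x v (q : 'cV[R]_n -> \bar R) gam (ts : nat -> R)
    (ds ws : nat -> 'cV[R]_n) D W : 0 < gam ->
  twice_epi_differentiable g x v q ->
  (forall j, 0 < ts j) -> ts @ \oo --> (0 : R) ->
  ds @ \oo --> D -> ws @ \oo --> W ->
  (\forall j \near \oo,
     prox g gam (x + gam *: v + ts j *: ws j) (x + ts j *: ds j)) ->
  forall e c, (q e <= c%:E)%E ->
  (q D <= (c + gam^-1 * (enorm (e - W) ^+ 2 - enorm (D - W) ^+ 2))%:E)%E.
Proof.
move=> gam0 [[gx _] _ epi] ts0 tsto0 dsD wsW prx e c qe.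
have [_ [es ese qes]] := epi ts ts0 tsto0 e.
have [/(_ ds dsD) qD _] := epi ts ts0 tsto0 D.
apply/lee_addgt0Pr => eps eps0; rewrite -EFinD.
apply: (limn_einf_near_le _ _ _ qD).
(* Half of [eps] covers the recovery sequence, half the convergence of the squared distances. *)
have eps20 : 0 < eps / 2 by rewrite divr_gt0.
have esc := limn_esup_near_lt _ _ _ (le_trans qes qe) eps20.
pose u j := gam^-1 * (enorm (es j - ws j) ^+ 2 - enorm (ds j - ws j) ^+ 2).
have uP : u @ \oo --> gam^-1 * (enorm (e - W) ^+ 2 - enorm (D - W) ^+ 2).
  by apply: cvgMr; apply: cvgB; apply: cvg_enorm_sqr; exact: cvgB.
have uc : \forall j \near \oo, u j <=
    gam^-1 * (enorm (e - W) ^+ 2 - enorm (D - W) ^+ 2) + eps / 2.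
  by apply: (cvgr_le _ uP); rewrite ltrDl.
near=> j.
have pj : prox g gam (x + gam *: v + ts j *: ws j) (x + ts j *: ds j).
  by near: j.
have ej : (second_quotient g x v (ts j) (es j) <= (c + eps / 2)%:E)%E.
  by apply: ltW; near: j.
apply: le_trans (prox_second_quotient _ _ _ _ _ _ _ _ _ gam0 (ts0 j) gx pj ej) _.
have : u j <= gam^-1 * (enorm (e - W) ^+ 2 - enorm (D - W) ^+ 2) + eps / 2.
  by near: j.
rewrite /u lee_fin; lra.
Unshelve. all: by end_near. Qed.

(** At s = - a / (|b| + 1) the polynomial equals (a / (|b| + 1))^2 (b - |b| - 1), which is negative
    unless a = 0. *)
Lemma quadratic_ge0_linear_eq0 (a b : R) :
  (forall s, 0 <= s * a + s ^+ 2 * b) -> a = 0.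
Proof.
move=> ab; apply/eqP; apply: contraT => a0.
have k0 : 0 < `|b| + 1 by rewrite ltr_wpDl.
have := ab (- (a / (`|b| + 1))).
have -> : - (a / (`|b| + 1)) * a + (- (a / (`|b| + 1))) ^+ 2 * b =
    (a / (`|b| + 1)) ^+ 2 * (b - (`|b| + 1)) by field; rewrite gt_eqF.
have p0 : 0 < (a / (`|b| + 1)) ^+ 2.
  by rewrite exprn_even_gt0//= mulf_neq0// invr_neq0// gt_eqF.
rewrite pmulr_rge0//; have := ler_norm b; lra.
Qed.

(** Minimality along the lines [D + s *: h] with [h] in [S] forces the term linear in s to vanish.
    Two terms in [M] appear because the quadratic form sees its symmetric part. *)
Lemma quadratic_on_min_stationary (S : {vspace 'cV[R]_n}) (M : 'M[R]_n) gam D W :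
  (forall e c, (quadratic_on S M e <= c%:E)%E ->
    (quadratic_on S M D <=
      (c + gam^-1 * (enorm (e - W) ^+ 2 - enorm (D - W) ^+ 2))%:E)%E) ->
  D \in S /\ forall h, h \in S ->
    dotp D (M *m h) + dotp h (M *m D) + 2 * gam^-1 * dotp D h =
    2 * gam^-1 * dotp W h.
Proof.
move=> Dmin.
have DS : D \in S.
  (* The competitor 0 has a finite value, so the value at [D] is finite too. *)
  have := Dmin 0 0; rewrite /quadratic_on mem0v mulmx0 dotp0r lexx => /(_ isT).
  by case: ifP.
split=> // h hS; apply/eqP; rewrite -subr_eq0; apply/eqP.
apply: (quadratic_ge0_linear_eq0 _ (dotp h (M *m h) + gam^-1 * dotp h h)) => s.
have := Dmin (D + s *: h) (dotp (D + s *: h) (M *m (D + s *: h))).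
rewrite /quadratic_on DS memvD// ?memvZ// lexx => /(_ isT).
rewrite lee_fin -subr_ge0; congr (0 <= _).
rewrite !enorm_sqr mulmxDr -scalemxAr !dotpE_lin.
rewrite (dotpC W D) (dotpC h D) (dotpC W h) (dotpC h W).
ring.
Qed.

(** The linearity defect [h0] lies in [S] and solves the homogeneous equation. Testing that equation
    with [D h0], and the equation of [D h0] with [h0], gives <Q h0, h0> = 0 by symmetry of the
    left-hand form; no coercivity of [M] enters. *)
Lemma stationary_map_linear (S : {vspace 'cV[R]_n}) (M Q : 'M[R]_n) (k : R)
    (D : 'cV[R]_n -> 'cV[R]_n) : k != 0 ->
  (forall h, dotp (Q *m h) h = 0 -> h = 0) ->
  (forall w, D w \in S /\ forall h, h \in S ->
    dotp (D w) (M *m h) + dotp h (M *m D w) + k * dotp (D w) h =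
    k * dotp (Q *m w) h) ->
  forall a u v, D (a *: u + v) = a *: D u + D v.
Proof.
move=> k0 Qpos DP a u v; apply/eqP; rewrite -subr_eq0; apply/eqP.
set h0 := _ - _.
have [D1S D1] := DP (a *: u + v); have [D2S D2] := DP u; have [D3S D3] := DP v.
have h0S : h0 \in S by rewrite memvB// memvD// memvZ.
have h0B h : h \in S -> dotp h0 (M *m h) + dotp h (M *m h0) + k * dotp h0 h = 0.
  move=> hS; have := D1 h hS; have := D2 h hS; have := D3 h hS.
  rewrite /h0 !mulmxBr !mulmxDr -!scalemxAr !dotpE_lin.
  set x1 := dotp (D (_ + _)) h; set x2 := dotp (D u) h; set x3 := dotp (D v) h.
  set y1 := dotp _ (M *m D (_ + _)); set y2 := dotp _ (M *m D u).
  set y3 := dotp _ (M *m D v).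
  set z1 := dotp (D (_ + _)) (M *m h); set z2 := dotp (D u) (M *m h).
  set z3 := dotp (D v) (M *m h).
  move=> e3 e2 e1.
  transitivity ((z1 + y1 + k * x1) - a * (z2 + y2 + k * x2) - (z3 + y3 + k * x3)).
    by ring.
  by rewrite e1 e2 e3; ring.
apply: Qpos; have [DhS Dh] := DP h0.
have := h0B _ DhS; rewrite addrAC -addrA addrC (dotpC h0 (D h0)) -addrA.
rewrite [X in _ + X]addrC addrA addrAC => e0; have := Dh _ h0S.
rewrite -[LHS](_ :
  dotp (D h0) (M *m h0) + k * dotp (D h0) h0 + dotp h0 (M *m D h0) = _); last by ring.
have -> : dotp (D h0) (M *m h0) + k * dotp (D h0) h0 + dotp h0 (M *m D h0) = 0.
  by rewrite -e0; ring.
by move/esym/eqP; rewrite mulf_eq0 (negPf k0) => /eqP.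
Qed.

Lemma taylor2_le (f : 'cV[R]_n -> R) x (eps : R) :
  (forall y, differentiable f y) -> differentiable (grad f) x -> 0 < eps ->
  \forall z \near x, f z <= f x + dotp (grad f x) (z - x) +
    (dotp (hess f x *m (z - x)) (z - x) + eps * enorm (z - x) ^+ 2) / 2.
Proof.
move=> df dgf eps0.
have /near_enormP[d d0 dP] := differentiable_frechet _ _ dgf _ eps0.
apply/near_enormP; exists d => // z zx.
rewrite -{1}(subrKC x z); apply: taylor1_le => // s /andP[s0 s1].
set h := z - x in zx *.
have := dP (x + s *: h); rewrite (addrAC x) subrr add0r enormZ ger0_norm//.
have sh : s * enorm h < d by apply: le_lt_trans zx; have := enorm_ge0 h; nra.
move=> /(_ sh); rewrite -/(hess f x) -scalemxAr.
set G := grad f (x + s *: h) - grad f x => Gh.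
have := dotp_le (G - s *: (hess f x *m h)) h.
rewrite dotpDl dotpNl dotpZl => dG.
have hh := enorm_ge0 h.
have : enorm (G - s *: (hess f x *m h)) * enorm h <= eps * (s * enorm h) * enorm h.
  by rewrite ler_wpM2r.
by rewrite expr2; lra.
Qed.

(** Along a recovery sequence for [w], the epi-limit bounds g and Taylor bounds f from above;
    quadratic growth then yields 2 c |w|^2 <= <w, M w> + <Hess f w, w>. *)
Lemma strong_min_second_order (f : 'cV[R]_n -> R) g x (S : {vspace 'cV[R]_n})
    (M : 'M[R]_n) :
  (forall y, differentiable f y) -> differentiable (grad f) x ->
  twice_epi_differentiable g x (- grad f x) (quadratic_on S M) ->
  strong_local_min (objective f g) x ->
  forall w, w \in S -> dotp w (M *m w) + dotp (hess f x *m w) w = 0 -> w = 0.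
Proof.
move=> df dgf [[gx _] _ epi] [c c0 xmin] w wS wMH.
apply/eqP; rewrite -enorm_eq0 -sqrf_eq0 eq_le sqr_ge0 andbT.
set N := enorm w ^+ 2.
(* For N > 0 the choice eps = c N / (1 + N) would give 2 c N <= c N. *)
suff wle eps : 0 < eps -> 2 * c * N <= eps * (1 + N).
  rewrite leNgt; apply/negP => N0.
  have : 0 < c * N / (1 + N) := divr_gt0 (mulr_gt0 c0 N0) (addr_gt0 ltr01 N0).
  move=> /wle; rewrite divfK; last by rewrite gt_eqF// addr_gt0.
  have : 0 < c * N := mulr_gt0 c0 N0.
  by lra.
move=> eps0.
have [_ [es esw qes]] := epi harmonic harmonic_gt0 cvg_harmonic w.
rewrite {1}/quadratic_on wS in qes.
have esq := limn_esup_near_lt _ _ _ qes eps0.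
have zx : (fun j => x + harmonic j *: es j) @ \oo --> x.
  rewrite -[X in _ --> X]addr0 -(scale0r w); apply: cvgD; first exact: cvg_cst.
  by apply: cvgZ => //; exact: cvg_harmonic.
have tayl := zx _ (taylor2_le _ _ _ df dgf eps0).
have smin := zx _ xmin.
pose u j := 2 * c * enorm (es j) ^+ 2 - dotp (hess f x *m es j) (es j)
  - eps * enorm (es j) ^+ 2.
have dotp_cvg : (fun j => dotp (hess f x *m es j) (es j)) @ \oo -->
    dotp (hess f x *m w) w.
  have polar a b : dotp a b = 4^-1 * (enorm (a + b) ^+ 2 - enorm (a - b) ^+ 2).
    by rewrite !enorm_sqr !dotpE_lin (dotpC b a); field.
  rewrite polar; under eq_fun do rewrite polar.
  have Hes : (fun j => hess f x *m es j) @ \oo --> hess f x *m w.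
    by apply: (cvg_comp _ _ esw); exact: mulmx_continuous.
  by apply: cvgMr; apply: cvgB; apply: cvg_enorm_sqr; [exact: cvgD|exact: cvgB].
have N_cvg : (fun j => enorm (es j) ^+ 2) @ \oo --> N.
  exact: cvg_enorm_sqr.
have uP : u @ \oo --> 2 * c * N - dotp (hess f x *m w) w - eps * N.
  by apply: cvgB; [apply: cvgB => //|]; apply: cvgMr.
suff : 2 * c * N - dotp (hess f x *m w) w - eps * N <= dotp w (M *m w) + eps by lra.
apply: (cvgr_to_le uP); near=> j.
have t0 : 0 < harmonic j :> R := harmonic_gt0 j.
have : (second_quotient g x (- grad f x) (harmonic j) (es j) <=
  (dotp w (M *m w) + eps)%:E)%E by apply: ltW; near: j.
rewrite second_quotient_le// => gle.
have fle : f (x + harmonic j *: es j) <= f x + harmonic j * dotp (grad f x) (es j) +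
    harmonic j ^+ 2 * (dotp (hess f x *m es j) (es j) + eps * enorm (es j) ^+ 2) / 2.
  have : f (x + harmonic j *: es j) <= f x + dotp (grad f x) (x + harmonic j *: es j - x)
    + (dotp (hess f x *m (x + harmonic j *: es j - x)) (x + harmonic j *: es j - x)
    + eps * enorm (x + harmonic j *: es j - x) ^+ 2) / 2 by near: j.
  rewrite (addrAC x) subrr add0r -scalemxAr !dotpE_lin enormZ exprMn gtr0_norm//.
  move=> /le_trans; apply; rewrite le_eqVlt; apply/orP; left; apply/eqP.
  by ring.
have : (objective f g x + (c * enorm (x + harmonic j *: es j - x) ^+ 2)%:E <=
  objective f g (x + harmonic j *: es j)%R)%E by near: j.
rewrite (addrAC x) subrr add0r enormZ exprMn gtr0_norm// /objective.
move: gle; case: (g x) gx => [r| |]// _ gle.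
(* The first-order terms of f and g cancel, as the subgradient is [- grad f x]. *)
move=> /le_trans/(_ (leeD2l _ gle)); rewrite -!EFinD lee_fin dotpNl => ineq.
have t20 : 0 < harmonic j ^+ 2 :> R by rewrite exprn_gt0.
rewrite /u -(ler_pM2l t20); lra.
Unshelve. all: by end_near. Qed.

End SecondOrderQuotients.

(** * Semiderivatives along lines and the strict estimate near the reference point *)

Section Semidifferentiability.
Context {R : realType} {n : nat}.
Implicit Types (F : 'cV[R]_n -> set 'cV[R]_n) (x y z w : 'cV[R]_n).

Lemma value_in F x : single_valued_at F x -> F x (value F x).
Proof. by move=> [v Fv]; apply: (@xgetPex _ 0); exists v; rewrite Fv. Qed.

Lemma value_unique F x y : single_valued_at F x -> F x y -> y = value F x.
Proof. by move=> Fs; have := value_in F x Fs; case: Fs => v -> -> ->. Qed.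

Lemma semiderivative_line F x w : semidifferentiable F x ->
  (fun t : R => t^-1 *: (value F (x + t *: w) - value F x)) @ (0 : R)^'+ -->
  semiderivative F x w.
Proof.
move=> [_ /(_ w) Fw]; apply: cvg_trans Fw.
move=> P [[A B] /= [A0 Bw] AB]; apply: filterS A0 => t At.
by apply: (AB (t, w)); split => //=; exact: nbhs_singleton.
Qed.

Lemma harmonic_at_right : (@harmonic R) @ \oo --> (0 : R)^'+.
Proof.
move=> A [e /= e0 eA]; have : \forall j \near \oo, ball (0 : R) e (harmonic j).
  exact: (cvg_ball (@cvg_harmonic R)).
by apply: filterS => j hj; exact: eA hj (harmonic_gt0 j).
Qed.

(* Integrates the semiderivative along the segment [y, x]. *)
Lemma lipschitz_semidifferentiable_estimate F xs (J : 'M[R]_n) :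
  lipschitz_semidifferentiable F xs ->
  (forall w, semiderivative F xs w = J *m w) ->
  exists d L : R, [/\ 0 < d, 0 <= L & forall x y m, m < d ->
    enorm (x - xs) <= m -> enorm (y - xs) <= m ->
    enorm (value F x - value F y - J *m (x - y)) <= L * m * enorm (x - y)].
Proof.
move=> [U [L [/near_enormP[d d0 dU] L0 FU FL]]] FJ; exists d, L; split => // x y m md xm ym.
have [->|xy] := eqVneq x y; first by rewrite !subrr mulmx0 subrr enorm0 mulr0.
set l := enorm (x - y); have l0 : 0 < l by rewrite enorm_gt0 subr_eq0.
pose w := l^-1 *: (x - y).
have w1 : enorm w = 1 by rewrite enormZ gtr0_norm ?invr_gt0// mulVf// gt_eqF.
have xE : x = y + l *: w by rewrite scalerA divff ?gt_eqF// scale1r subrKC.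
pose z t := y + t *: w.
have zm t : 0 <= t <= l -> enorm (z t - xs) <= m.
  move=> /andP[t0 tl].
  have -> : z t - xs = (1 - t / l) *: (y - xs) + (t / l) *: (x - xs).
    rewrite [in RHS]xE /z [LHS]addrAC (addrAC y (l *: w)); move: (y - xs) => b.
    rewrite [in RHS]scalerDr addrA -scalerDl subrK scale1r.
    by rewrite [in RHS](scalerA (t / l) l w) divfK// gt_eqF.
  have tl0 : 0 <= t / l by rewrite divr_ge0// ltW.
  have tl1 : t / l <= 1 by rewrite ler_pdivrMr// mul1r.
  apply: le_trans (enormD _ _) _; rewrite !enormZ !ger0_norm ?subr_ge0//.
  nra.
(* Subtracting the linear part leaves right slopes of norm at most L m. *)
pose G t := value F (z t) - t *: (J *m w).
have zD t h : z (t + h) = z t + h *: w by rewrite /z scalerDl addrA.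
have -> : value F x - value F y - J *m (x - y) = G l - G 0.
  rewrite /G {1}xE -/(z l) {1}/z scale0r /z !scale0r subr0 addr0 addrAC.
  by rewrite scalemxAr scalerA divff ?gt_eqF// scale1r.
apply: right_mean_value_le => [|t e /andP[t0 tl] e0|t e /andP[t0 tl] e0].
- exact: ltW.
- have tI : 0 <= t <= l by rewrite t0 ltW.
  have Uz : U (z t) by apply: dU; exact: le_lt_trans (zm _ tI) md.
  have [_ Fz] := FU _ Uz.
  have /cvg_enormP/cvgrPdist_le/(_ _ e0) := semiderivative_line F (z t) w Fz.
  apply: filter_app; near=> h; have h0 : 0 < h by near: h; exact: nbhs_right_gt.
  rewrite sub0r normrN ger0_norm ?enorm_ge0// => qe.
  have -> : G (t + h) - G t =
      h *: ((h^-1 *: (value F (z t + h *: w) - value F (z t)) - semiderivative F (z t) w)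
            + (semiderivative F (z t) w - J *m w)).
    rewrite addrA subrK scalerBr scalerA divff ?gt_eqF// scale1r /G zD scalerDl.
    by apply/colP => i; rewrite !mxE; ring.
  rewrite enormZ gtr0_norm// mulrC ler_pM2r//.
  apply: le_trans (enormD _ _) _; rewrite addrC; apply: lerD => //.
  rewrite -FJ; apply: le_trans (FL _ _ Uz w1) _.
  by rewrite ler_wpM2l// zm.
(* The semiderivative in direction [- w] makes the backward increment O(h), which gives leftward
   continuity. *)
- have tI : 0 <= t <= l by rewrite ltW.
  have Uz : U (z t) by apply: dU; exact: le_lt_trans (zm _ tI) md.
  have [_ Fz] := FU _ Uz.
  have /cvg_enormP/cvgrPdist_le/(_ _ ltr01) := semiderivative_line F (z t) (- w) Fz.
  set D := semiderivative F (z t) (- w).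
  pose k := 1 + enorm D + enorm (J *m w).
  have k0 : 0 < k by have := enorm_ge0 D; have := enorm_ge0 (J *m w); rewrite /k; lra.
  apply: filter_app; near=> h; have h0 : 0 < h by near: h; exact: nbhs_right_gt.
  rewrite sub0r normrN ger0_norm ?enorm_ge0// => qe.
  have -> : G (t - h) - G t =
      h *: ((h^-1 *: (value F (z t + h *: - w) - value F (z t)) - D) + D + J *m w).
    rewrite subrK scalerDr scalerA divff ?gt_eqF// scale1r /G zD scalerBl scaleNr scalerN.
    by apply/colP => i; rewrite !mxE; ring.
  rewrite enormZ gtr0_norm//; apply: (@le_trans _ _ (h * k)).
    rewrite ler_pM2l// /k; apply: le_trans (enormD _ _) _; rewrite lerD2r.
    by apply: le_trans (enormD _ _) _; rewrite lerD2r.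
  rewrite -ler_pdivlMr//; near: h; apply: nbhs_right_le; exact: divr_gt0.
Unshelve. all: by end_near. Qed.

End Semidifferentiability.

(** * Differentiability of the residual and injectivity of its Jacobian *)

Section ResidualJacobian.
Context {R : realType} {n : nat}.
Variables (f : 'cV[R]_n -> R) (g : 'cV[R]_n -> \bar R) (gam : R) (xs : 'cV[R]_n).
Variables (S : {vspace 'cV[R]_n}) (M : 'M[R]_n).
Hypotheses (gam0 : 0 < gam) (dgf : differentiable (grad f) xs).
Hypothesis epi : twice_epi_differentiable g xs (- grad f xs) (quadratic_on S M).
Hypothesis sdF : semidifferentiable (fb_residual f g gam) xs.
Hypothesis Txs : fb_map f g gam xs xs.

Local Notation F := (fb_residual f g gam).

Lemma fb_map_residual_value x : single_valued_at F x ->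
  fb_map f g gam x (x - gam *: value F x).
Proof.
move=> /value_in[z Tz vz].
suff -> : x - gam *: value F x = z by [].
by rewrite -vz scalerA divff ?gt_eqF// scale1r subKr.
Qed.

Lemma residual_value0 : value F xs = 0.
Proof.
apply/esym/value_unique; first by case: sdF => /nbhs_singleton.
by exists xs => //; rewrite subrr scaler0.
Qed.

(** The rescaled forward-backward points [ds] converge to [D] and the rescaled gradient steps [ws]
    to (I - gam Hess f) w, so [twice_epi_prox_limit] applies. *)
Lemma residual_semiderivative_stationary w :
  let D := w - gam *: semiderivative F xs w in
  D \in S /\ forall h, h \in S ->
    dotp D (M *m h) + dotp h (M *m D) + 2 * gam^-1 * dotp D h =
    2 * gam^-1 * dotp ((1%:M - gam *: hess f xs) *m w) h.
Proof.
move=> D; apply: quadratic_on_min_stationary.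
pose t : nat -> R := harmonic.
pose ds j := w - gam *: ((t j)^-1 *: (value F (xs + t j *: w) - value F xs)).
pose ws j := w - gam *: ((t j)^-1 *: (grad f (xs + t j *: w) - grad f xs)).
apply: (twice_epi_prox_limit g xs (- grad f xs) _ gam t ds ws) => //.
- exact: harmonic_gt0.
- exact: cvg_harmonic.
- apply: cvgB; first exact: cvg_cst.
  apply: cvgZr; apply: (cvg_comp t (fun s : R =>
    s^-1 *: (value F (xs + s *: w) - value F xs)) harmonic_at_right).
  exact: semiderivative_line.
- rewrite mulmxBl mul1mx -scalemxAl; apply: cvgB; first exact: cvg_cst.
  apply: cvgZr; apply: (cvg_comp t (fun s : R =>
    s^-1 *: (grad f (xs + s *: w) - grad f xs)) harmonic_at_right).
  exact: differentiable_line_quotient.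
case: sdF => sF _.
have : \forall j \near \oo, single_valued_at F (xs + t j *: w).
  exact: harmonic_at_right _ (near_line xs w _ sF).
apply: filterS => j sj.
have tj0 : t j != 0 by rewrite gt_eqF// harmonic_gt0.
have := fb_map_residual_value _ sj; rewrite /fb_map.
have tZ (u : 'cV[R]_n) : t j *: (w - gam *: ((t j)^-1 *: u)) = t j *: w - gam *: u.
  by rewrite scalerBr !scalerA mulrAC divff// mul1r.
have yE (u u' v : 'cV[R]_n) :
    xs + gam *: - u + (v - gam *: (u' - u)) = xs + v - gam *: u'.
  by apply/colP => i; rewrite !mxE; ring.
have dsE : xs + t j *: ds j = xs + t j *: w - gam *: value F (xs + t j *: w).
  by rewrite /ds tZ residual_value0 subr0 addrA.
(* Puts the prox centre into the form x + gam v + t w with v = - grad f(xs). *)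
have wsE : xs + gam *: - grad f xs + t j *: ws j =
    xs + t j *: w - gam *: grad f (xs + t j *: w).
  by rewrite /ws tZ; exact: yE.
by rewrite dsE wsE; have := fb_map_residual_value _ sj; rewrite /fb_map.
Qed.

Variable L : R.
Hypothesis gfL : forall y z, enorm (grad f y - grad f z) <= L * enorm (y - z).
Hypothesis gamL : gam * L < 1.

(** Since |Hess f h| <= L |h| and gam L < 1, the form of I - gam Hess f is positive definite, so the
    semiderivative is linear. Its joint limits are Hadamard limits, hence the Frechet derivative
    exists. *)
Lemma residual_differentiable :
  differentiable (value F) xs /\
  (forall w, semiderivative F xs w = jac (value F) xs *m w).
Proof.
have k0 : 2 * gam^-1 != 0 by rewrite mulf_neq0// invr_neq0// gt_eqF.
have Qpos h : dotp ((1%:M - gam *: hess f xs) *m h) h = 0 -> h = 0.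
  rewrite mulmxBl mul1mx -scalemxAl !dotpE_lin -enorm_sqr => hQ.
  apply/eqP; rewrite -enorm_eq0 -sqrf_eq0 eq_le sqr_ge0 andbT.
  have := dotp_le (hess f xs *m h) h.
  have : enorm (hess f xs *m h) * enorm h <= L * enorm h * enorm h.
    by rewrite ler_wpM2r ?enorm_ge0//; exact: enorm_jac_le.
  rewrite -mulrA -expr2; set N := enorm h ^+ 2 in hQ *; set a := dotp _ _ in hQ *.
  have gamL' : 0 < 1 - gam * L by rewrite subr_gt0.
  move=> h1 h2; rewrite -(pmulr_rle0 _ gamL').
  have : gam * a <= gam * (L * N) by rewrite ler_pM2l// (le_trans h2).
  lra.
pose D (w : 'cV[R]_n) := w - gam *: semiderivative F xs w.
have Dlin : forall a u v, D (a *: u + v) = a *: D u + D v.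
  apply: (stationary_map_linear S M (1%:M - gam *: hess f xs) (2 * gam^-1)) => //.
  exact: residual_semiderivative_stationary.
have [A DA] := linear_matrix D Dlin.
pose J := gam^-1 *: (1%:M - A).
have sJ w : semiderivative F xs w = J *m w.
  rewrite -scalemxAl mulmxBl mul1mx -DA /D subKr scalerA mulVf ?scale1r//.
  by rewrite gt_eqF.
have [|dF jF] := frechet_differentiable (value F) xs J.
  apply: hadamard_frechet => w; rewrite -sJ.
  by case: sdF => _ /(_ w).
by split => // w; rewrite jF sJ.
Qed.

(** If J w = 0 then D = w, and stationarity tested with [w] reduces to <w, M w> + <Hess f w, w> =
    0. *)
Lemma residual_jacobian_injective :
  (forall y, differentiable f y) -> strong_local_min (objective f g) xs ->
  forall w : 'cV[R]_n, jac (value F) xs *m w = 0 -> w = 0.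
Proof.
move=> df xmin w; have [_ <-] := residual_differentiable => sw0.
have := residual_semiderivative_stationary w.
rewrite /= sw0 scaler0 subr0 => -[wS /(_ w wS)].
rewrite mulmxBl mul1mx -scalemxAl !dotpE_lin => e.
apply: (strong_min_second_order f g xs S M) => //.
have gi : gam^-1 * gam = 1 by rewrite mulVf// gt_eqF.
set a := dotp w _ in e *; set b := dotp (hess f xs *m w) w in e *.
have : 2 * (a + b) = 2 * (gam^-1 * gam - 1) * (- b) + 0 by move: e gi; nra.
by rewrite gi subrr mulr0 mul0r addr0 => /eqP; rewrite mulf_eq0 pnatr_eq0 => /eqP.
Qed.

End ResidualJacobian.

(** * Bounds on the envelope and closedness of the forward-backward map *)

Section ForwardBackwardEnvelope.
Context {R : realType} {n : nat}.
Variables (f : 'cV[R]_n -> R) (g : 'cV[R]_n -> \bar R) (gam L : R).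
Hypotheses (gam0 : 0 < gam) (df : forall x, differentiable f x).
Hypothesis gfL : forall x y, enorm (grad f x - grad f y) <= L * enorm (x - y).
Hypothesis L0 : 0 <= L.
Implicit Types (x y z : 'cV[R]_n).

Lemma descent_upper y z :
  f z <= f y + dotp (grad f y) (z - y) + L / 2 * enorm (z - y) ^+ 2.
Proof.
rewrite -{1}(subrKC y z).
apply: le_trans (taylor1_le f y (z - y) (L * enorm (z - y) ^+ 2) df _) _; last by lra.
move=> s /andP[s0 s1]; apply: le_trans (dotp_le _ _) _.
have := gfL (y + s *: (z - y)) y.
rewrite (addrAC y) subrr add0r enormZ ger0_norm// => h.
have := ler_wpM2r (enorm_ge0 (z - y)) h; rewrite expr2; lra.
Qed.

(** The descent inequality from z to y costs L / 2, and replacing the gradient at z by that at y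
    costs L. *)
Lemma descent_lower y z :
  f y + dotp (grad f y) (z - y) <= f z + 3 / 2 * L * enorm (z - y) ^+ 2.
Proof.
have := descent_upper z y; have := dotp_le (grad f y - grad f z) (z - y).
have := ler_wpM2r (enorm_ge0 (z - y)) (gfL y z).
rewrite (enorm_distC y z) dotpDl dotpNl -(opprB z y) dotpNr expr2.
lra.
Qed.

Lemma fb_envelope_le y z :
  (fb_envelope f g gam y <=
   objective f g z + ((3 / 2 * L + (2 * gam)^-1) * enorm (z - y) ^+ 2)%:E)%E.
Proof.
apply: (@le_trans _ _ ((f y + dotp (grad f y) (z - y)
  + (2 * gam)^-1 * enorm (z - y) ^+ 2)%:E + g z)%E).
  by apply: ereal_inf_lbound; exists z.
rewrite /objective addeAC -EFinD leeD2r// lee_fin.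
have := descent_lower y z; lra.
Qed.

(** Completing the square turns the model into the prox objective up to a constant, so [z] minimizes
    it; the descent inequality then replaces the linearization by f(z). *)
Lemma fb_envelope_ge y z : fb_map f g gam y z ->
  (objective f g z + ((1 - gam * L) / (2 * gam) * enorm (z - y) ^+ 2)%:E <=
   fb_envelope f g gam y)%E.
Proof.
move=> Tz; apply: le_ereal_inf_tmp => _ [z' _ <-].
have modelE w : f y + dotp (grad f y) (w - y) + (2 * gam)^-1 * enorm (w - y) ^+ 2 =
    (2 * gam)^-1 * enorm (w - (y - gam *: grad f y)) ^+ 2
    + (f y - gam / 2 * enorm (grad f y) ^+ 2).
  have -> : w - (y - gam *: grad f y) = w - y + gam *: grad f y.
    by rewrite opprB addrA addrAC.
  move: (w - y) => u.
  rewrite !enorm_sqr !dotpE_lin (dotpC (grad f y) u); field.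
  by rewrite gt_eqF.
apply: (@le_trans _ _ ((f y + dotp (grad f y) (z - y)
    + (2 * gam)^-1 * enorm (z - y) ^+ 2)%:E + g z)%E).
  rewrite /objective addeAC -EFinD leeD2r// lee_fin.
  have -> : (1 - gam * L) / (2 * gam) = (2 * gam)^-1 - L / 2.
    by field; rewrite gt_eqF.
  by have := descent_upper y z; lra.
have addeE w (a b : R) : ((a + b)%:E + g w = g w + a%:E + b%:E)%E.
  by rewrite EFinD -[RHS]addeA [RHS]addeC.
by rewrite !modelE !addeE leeD2r//; exact: Tz.
Qed.

(** If some [w] did strictly better than [z] at [x], lower semicontinuity of g would make [w] beat
    [zk k] at [xk k] for some k. *)
Lemma fb_map_closed (xk zk : nat -> 'cV[R]_n) x z :
  lower_semicontinuous g -> (forall z, g z != -oo%E) ->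
  (forall k, fb_map f g gam (xk k) (zk k)) ->
  xk @ \oo --> x -> zk @ \oo --> z -> fb_map f g gam x z.
Proof.
move=> glsc gNy Tk xkx zkz w; rewrite leNgt; apply/negP.
have gw := gNy w; case gwE : (g w) gw => [r| |]// _; last first.
  by rewrite addye// ltNge leey.
set u := fun y => y - gam *: grad f y.
have ukx : (fun k => u (xk k)) @ \oo --> u x.
  apply: cvgB => //; apply: cvgZr; apply/cvg_enormP.
  have L10 : 0 < L + 1 by rewrite ltr_wpDl.
  have /cvg_enormP xkx0 := xkx.
  apply: (@squeeze_cvgr _ _ _ _ (fun=> 0) (fun k => L * enorm (xk k - x))).
  - by near=> k; rewrite enorm_ge0 gfL.
  - exact: cvg_cst.
  - by rewrite -[X in _ --> X](mulr0 L); apply: cvgMr.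
have qcvg (v : nat -> 'cV[R]_n) (v0 : 'cV[R]_n) : v @ \oo --> v0 ->
    (fun k => (2 * gam)^-1 * enorm (v k - u (xk k)) ^+ 2) @ \oo -->
    (2 * gam)^-1 * enorm (v0 - u x) ^+ 2.
  move=> vv0; apply: cvgMr; apply: cvg_enorm_sqr.
  exact: (cvgB vv0 ukx).
rewrite -EFinD -lteBlDr// -EFinB => gz.
set b := (2 * gam)^-1 * enorm (z - _) ^+ 2 in gz.
set c := (2 * gam)^-1 * enorm (w - _) ^+ 2 in gz.
(* [a] lies below g(z) and above the value [r + c - b] at which [w] and [z] would tie; half the gap
   absorbs each squared distance. It exists also when g(z) is infinite. *)
have [a [ag /andP[a1 a2]]] : exists a : R, (a%:E < g z)%E /\ r + c - b < a < r + c - b + 1.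
  case gzE : (g z) gz => [s| |]// gz.
    exists (Num.min ((r + c - b + s) / 2) (r + c - b + 1/2)).
    rewrite lte_fin in gz; rewrite lte_fin; split.
      by rewrite gt_min; apply/orP; left; lra.
    by rewrite lt_min gt_min; apply/andP; split; [apply/andP; split|apply/orP; right]; lra.
  by exists (r + c - b + 1/2); rewrite ltry; split => //; apply/andP; split; lra.
have [V Vz Va] := glsc z a ag.
have e0 : 0 < (a - (r + c - b)) / 2 by lra.
have h1 : \forall k \near \oo,
    (2 * gam)^-1 * enorm (w - u (xk k)) ^+ 2 <= c + (a - (r + c - b)) / 2.
  by apply: (cvgr_le _ (qcvg (fun=> w) w (cvg_cst _))); rewrite ltrDl.
have h2 : \forall k \near \oo,
    b - (a - (r + c - b)) / 2 <= (2 * gam)^-1 * enorm (zk k - u (xk k)) ^+ 2.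
  by apply: (cvgr_ge _ (qcvg zk z zkz)); rewrite gtrBl.
have h3 : \forall k \near \oo, (a%:E < g (zk k))%E.
  have zV : \forall k \near \oo, V (zk k) by exact: zkz.
  by apply: filterS zV => k; exact: Va.
have [k [[H1 H2] H3]] := filter_ex (filterI (filterI h1 h2) h3).
have := Tk k w; rewrite gwE -EFinD; move: H3; rewrite -/(u (xk k)).
case: (g (zk k)) => [s| |]//.
  rewrite lte_fin -EFinD lee_fin => H3 H4; move: H1 H2 H3 H4 a1; clear; lra.
Unshelve. all: by end_near. Qed.

End ForwardBackwardEnvelope.

(* [e] are the envelope values, [P] their running averages and [q] the decrease
   required by the line search. *)
Lemma linesearch_bookkeeping {R : realType} (e P p q : nat -> R) (m pmin : R) :
  0 < pmin -> (forall k, pmin <= p k <= 1) -> (forall k, 0 <= q k) ->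
  (forall k, m <= e k) -> P 0%N = e 0%N ->
  (forall k, e k.+1 <= P k - q k) ->
  (forall k, P k.+1 = (1 - p k) * P k + p k * e k.+1) ->
  (forall k, e k <= P k) /\ (forall N, \sum_(0 <= k < N) q k <= (P 0%N - m) / pmin).
Proof.
move=> pm0 pI q0 me P0 eP PS.
have eleP k : e k <= P k.
  case: k => [|k]; first by rewrite P0.
  rewrite PS; have := pI k; have := eP k; have := q0 k; nra.
split=> // N; rewrite ler_pdivlMr//.
suff : (\sum_(0 <= k < N) q k) * pmin <= P 0%N - P N.
  by have := eleP N; have := me N; lra.
elim: N => [|N IH]; first by rewrite big_geq// mul0r subrr.
rewrite big_nat_recr//= mulrDl.
(* The average drops by p_N (P_N - e_{N+1}), which is at least pmin q_N. *)
have : q N * pmin <= P N - P N.+1.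
  rewrite PS; have := pI N; have := eP N; have := q0 N; nra.
lra.
Qed.

(** * Summability of the squared residuals *)

Section LineSearch.
Context {R : realType} {n : nat}.
Variables (f : 'cV[R]_n -> R) (g : 'cV[R]_n -> \bar R) (gam L : R).
Hypotheses (gam0 : 0 < gam) (df : forall x, differentiable f x).
Hypothesis gfL : forall x y, enorm (grad f x - grad f y) <= L * enorm (x - y).
Hypothesis gamL : gam * L < 1.
Variables (beta pmin sigma : R) (x xbar r d : nat -> 'cV[R]_n) (tau p : nat -> R).
Variable Phi : nat -> \bar R.
Hypotheses (pmin0 : 0 < pmin) (sigma0 : 0 < sigma).
Hypothesis zf : zerofpr f g gam beta pmin sigma x xbar r d tau p Phi.
Hypothesis gpr : proper_fun g.
Hypothesis argm : argmin (objective f g) !=set0.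

Let env k := fb_envelope f g gam (x k).

Lemma objective_lower_bound : exists m : R, forall z, (m%:E <= objective f g z)%E.
Proof.
case: argm => z zmin; case: gpr => gNy [z0 z0y].
have : (objective f g z < +oo)%E.
  apply: le_lt_trans (zmin z0) _; rewrite /objective.
  by case: (g z0) (gNy z0) z0y => [s| |]// _ _; rewrite -EFinD ltry.
rewrite /objective; case gzE : (g z) (gNy z) => [s| |]// _ _.
exists (f z + s) => w; have := zmin w.
by rewrite {1}/objective gzE -EFinD.
Qed.

Lemma env_ge k : (objective f g (xbar k) +
  (gam * (1 - gam * L) / 2 * enorm (r k) ^+ 2)%:E <= env k)%E.
Proof.
apply: le_trans (fb_envelope_ge _ _ _ _ gam0 df gfL _ _ (zerofpr_xbar zf k)).
rewrite leeD2l// lee_fin (zerofpr_r zf) enormZ exprMn real_normK ?num_real//.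
rewrite (enorm_distC (x k)) le_eqVlt; apply/orP; left; apply/eqP.
by field; rewrite gt_eqF.
Qed.

(** The envelope is bounded below by inf phi and above through a point of dom g. All values are thus
    finite and the recursion can be read over the reals. *)
Lemma linesearch_summable : exists C : R,
  (forall k, (env k <= Phi k)%E) /\
  (forall N, \sum_(0 <= k < N) enorm (r k) ^+ 2 <= C).
Proof.
have [m mP] := objective_lower_bound; case: gpr => gNy [z0 z0y].
have c0 : 0 <= gam * (1 - gam * L) / 2.
  by rewrite divr_ge0// mulr_ge0// ltW// subr_gt0.
have envm k : (m%:E <= env k)%E.
  apply: le_trans (env_ge k); apply: le_trans (mP (xbar k)) _.
  by rewrite leeDl// lee_fin mulr_ge0// sqr_ge0.
have envfin k : env k \is a fin_num.
  rewrite fin_numE; apply/andP; split.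
    by apply/eqP => e; have := envm k; rewrite e.
  apply/eqP => e; have := fb_envelope_le f g gam L df gfL (x k) z0.
  rewrite -/(env k) e /objective.
  by case: (g z0) (gNy z0) z0y => [s| |]// _ _; rewrite -!EFinD.
have envP k : (env k.+1 <= Phi k - (sigma * enorm (r k) ^+ 2)%:E)%E.
  by have [[_ _ +] _] := zerofpr_tau zf k; rewrite /env (zerofpr_x zf).
have Phifin k : Phi k \is a fin_num.
  elim: k => [|k IH]; first by rewrite (zerofpr_init zf) envfin.
  by rewrite (zerofpr_Phi zf) fin_numD !fin_numM// envfin.
have [] := linesearch_bookkeeping (fun k => fine (env k)) (fun k => fine (Phi k)) p
  (fun k => sigma * enorm (r k) ^+ 2) m pmin pmin0 (zerofpr_p zf).
- by move=> k; rewrite mulr_ge0 ?sqr_ge0// ltW.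
- by move=> k; rewrite -lee_fin fineK.
- by rewrite (zerofpr_init zf).
- by move=> k; rewrite -lee_fin EFinB !fineK.
- move=> k; apply: EFin_inj.
  by rewrite fineK// EFinD !EFinM !fineK// (zerofpr_Phi zf).
move=> eP sumP; exists ((fine (Phi 0%N) - m) / pmin / sigma); split=> [k|N].
  by rewrite -(fineK (envfin k)) -(fineK (Phifin k)) lee_fin.
by rewrite ler_pdivlMr// mulrC mulr_sumr.
Qed.

End LineSearch.

(** * The Dennis-More condition and the quality of the resulting step *)

Section DennisMore.
Context {R : realType} {n : nat}.

Lemma superlinear_small_ratio (w : nat -> 'cV[R]_n) ws :
  (forall k, w k != ws) ->
  (forall e, 0 < e -> \forall k \near \oo, enorm (w k.+1 - ws) <= e * enorm (w k - ws)) ->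
  superlinear w ws.
Proof.
move=> wN we; split => //; apply/cvgrPdist_le => e /we; apply: filterS => k wk.
rewrite sub0r normrN ger0_norm ?divr_ge0 ?enorm_ge0//.
by rewrite ler_pdivrMr// enorm_gt0 subr_eq0.
Qed.

(** J (v + d) is the difference of two remainders, small relative to |d| and |v|, and |d| <= |v + d|
    + |v|. It is applied with v_k = xbar^k - xs. *)
Lemma dennis_more_step (J : 'M[R]_n) (c : R) (v d rb : nat -> 'cV[R]_n) : 0 < c ->
  (forall w, c * enorm w <= enorm (J *m w)) ->
  (forall e, 0 < e -> \forall k \near \oo, enorm (rb k + J *m d k) <= e * enorm (d k)) ->
  (forall e, 0 < e -> \forall k \near \oo, enorm (rb k - J *m v k) <= e * enorm (v k)) ->
  forall e, 0 < e -> \forall k \near \oo, enorm (v k + d k) <= e * enorm (v k).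
Proof.
move=> c0 cJ rd rv e e0.
(* From c |v + d| <= h |v + d| + 2 h |v|, the bound c / 2 absorbs the first term and c e / 4 makes
   the second at most (c / 2) e |v|. *)
pose h := Num.min (c / 2) (c * e / 4).
have h0 : 0 < h by rewrite lt_min !divr_gt0// mulr_gt0.
have h1 : h <= c / 2 by rewrite ge_min lexx.
have h2 : h <= c * e / 4 by rewrite ge_min lexx orbT.
near=> k.
have rdk : enorm (rb k + J *m d k) <= h * enorm (d k) by near: k; exact: rd.
have rvk : enorm (rb k - J *m v k) <= h * enorm (v k) by near: k; exact: rv.
have := cJ (v k + d k).
have -> : J *m (v k + d k) = (rb k + J *m d k) - (rb k - J *m v k).
  by rewrite mulmxDr; apply/colP => i; rewrite !mxE; ring.
have := enormB (rb k + J *m d k) (rb k - J *m v k).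
have := enormB (v k + d k) (v k); rewrite (addrC (v k)) addrK.
have := enorm_ge0 (v k); have := enorm_ge0 (d k + v k).
move: (enorm (_ - _)) rdk rvk => T; nra.
Unshelve. all: by end_near. Qed.

(** Invertibility propagates by [broyden_update_inverse]. The squared Frobenius distance from the
    inverse of H_k to J is then quasi-decreasing with summable error, which sends its decrements to
    0. *)
Lemma broyden_dennis_more (tb : R) (H : nat -> 'M[R]_n) (J : 'M[R]_n)
    (s y : nat -> 'cV[R]_n) (eta : nat -> R) (K : nat) (C : R) :
  0 < tb < 1 -> H 0%N \in unitmx -> (forall k, s k != 0) ->
  (forall k, H k.+1 = broyden_update tb (H k) (s k) (y k)) ->
  (forall k, (K <= k)%N -> (enorm (y k - J *m s k) / enorm (s k)) ^+ 2 <= eta k) ->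
  (forall N, \sum_(K <= k < N) eta k <= C) ->
  (forall k, H k \in unitmx) /\
  (fun k => enorm ((invmx (H k) - J) *m s k) / enorm (s k)) @ \oo --> 0.
Proof.
move=> tb01 H0 s0 HS ys etaC.
have step k : H k \in unitmx -> H k.+1 \in unitmx /\
    exists2 th : R, 1 - tb <= th <= 1 + tb & invmx (H k.+1) = invmx (H k) +
      ((th / enorm (s k) ^+ 2) *: (y k - invmx (H k) *m s k)) *m (s k)^T.
  move=> Hk.
  have [th thb] := broyden_update_inverse tb _ _ (s k) (y k) tb01 (s0 k) (mulmxV Hk).
  rewrite -HS => HB; have [HSu _] := mulmx1_unit HB.
  split=> //; exists th => //.
  by rewrite -[LHS]mulmx1 -HB mulKmx.
have Hu k : H k \in unitmx by elim: k => // k /step[].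
split=> //.
pose kp := 1 - tb ^+ 2.
have kp0 : 0 < kp by rewrite /kp; case/andP: tb01 => ? ?; nra.
pose q k := enorm ((invmx (H k) - J) *m s k) / enorm (s k).
have q0 k : 0 <= q k by rewrite divr_ge0 ?enorm_ge0.
have k8 : 0 < 4 + 8 / kp by rewrite addr_gt0// divr_gt0.
have kq : (fun k => kp / 2 * q k ^+ 2) @ \oo --> 0.
  apply: (quasi_decrease_cvg0 (fun k => frob2 (invmx (H k) - J)) _
    (fun k => (4 + 8 / kp) * eta k) ((4 + 8 / kp) * C) K).
  - by move=> k; exact: frob2_ge0.
  - by move=> k; rewrite mulr_ge0 ?sqr_ge0// divr_ge0// ltW.
  - by move=> N; rewrite -mulr_sumr ler_pM2l.
  - move=> k Kk; have [_ [th thb ->]] := step k (Hu k).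
    apply: le_trans (broyden_deterioration _ _ _ J _ (y k) tb01 (s0 k) thb) _.
    by rewrite lerD2l ler_pM2l// ys.
apply/cvgrPdist_lt => e e0.
have ke : 0 < kp / 2 * e ^+ 2 by rewrite mulr_gt0 ?exprn_gt0 ?divr_gt0.
have kqe : \forall k \near \oo, kp / 2 * q k ^+ 2 < kp / 2 * e ^+ 2.
  exact: (cvgr_lt _ kq).
apply: filterS kqe => k.
rewrite ltr_pM2l ?divr_gt0// ltr_pXn2r ?nnegrE ?q0 ?(ltW e0)//.
by rewrite -/(q k) sub0r normrN ger0_norm.
Qed.

Lemma sum_tail_le (u : nat -> R) (C : R) :
  (forall k, 0 <= u k) -> (forall N, \sum_(0 <= k < N) u k <= C) ->
  forall K N, \sum_(K <= k < N) u k <= C.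
Proof.
move=> u0 uC K N; apply: le_trans (uC N).
have [KN|NK] := leqP K N; last by rewrite [leLHS]big_geq ?sumr_ge0// ltnW.
by rewrite [leRHS](big_cat_nat _ KN)//= lerDr sumr_ge0.
Qed.

End DennisMore.

(** * Superlinear convergence of the Broyden iterates *)

Theorem theorem5p11 (R : realType) (n : nat)
    (f : 'cV[R]_n -> R) (g : 'cV[R]_n -> \bar R) (xs : 'cV[R]_n)
    (gam beta pmin sigma thetabar : R)
    (x xbar r d rbar : nat -> 'cV[R]_n) (H : nat -> 'M[R]_n)
    (tau p : nat -> R) (Phi : nat -> \bar R) :
  standing_assumptions f g ->
  zerofpr_params f g gam beta pmin sigma ->
  assumption2 f g xs ->
  strong_local_min (objective f g) xs ->
  lipschitz_semidifferentiable (fb_residual f g gam) xs ->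
  zerofpr f g gam beta pmin sigma x xbar r d tau p Phi ->
  broyden_directions (fb_residual f g gam) thetabar x xbar r d rbar H ->
  x @ \oo --> xs ->
  let Rgam := value (fb_residual f g gam) in
  [/\ (* JR_gam(xs) exists *)
      differentiable Rgam xs,
      (fun k => enorm (rbar k + jac Rgam xs *m d k) / enorm (d k)) @ \oo --> 0,
      \forall k \near \oo, tau k = 1 &
      [/\ superlinear x xs, superlinear xbar xs & superlinear r 0]].
Proof.
move=> [df Lne [gpr glsc _] argm] [[gam0 _] /andP[beta0 beta1] /andP[pmin0 _] sig].
move=> [_ dhess _ [S [M epi]]] xmin lsd zf bd xxs Rg.
set L := lipschitz_modulus (grad f) in sig.
have gfL : forall y z, enorm (grad f y - grad f z) <= L * enorm (y - z).
  exact: lipschitz_modulusP.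
have L0 : 0 <= L by exact: lipschitz_modulus_ge0.
have /andP[sigma0 sigma_lt] := sig.
have gamL : gam * L < 1.
  have : 0 < gam * ((1 - gam * L) / 2) by exact: lt_trans sigma_lt.
  by rewrite pmulr_rgt0//; lra.
have [dgf _] := nbhs_singleton dhess.
have sdF : semidifferentiable (fb_residual f g gam) xs.
  by case: lsd => U [L' [Uxs _ FU _]]; have [] := FU xs (nbhs_singleton Uxs).
have sF : \forall z \near xs, single_valued_at (fb_residual f g gam) z by case: sdF.
have [C [envPhi sumC]] := linesearch_summable f g gam L gam0 df gfL gamL beta pmin
  sigma x xbar r d tau p Phi pmin0 sigma0 zf gpr argm.
have envge := env_ge f g gam L gam0 df gfL beta pmin sigma x xbar r d tau p Phi zf.
(* [C] minus the partial sums is nonnegative and decreases by exactly |r^k|^2. *)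
have r20 : (fun k => enorm (r k) ^+ 2) @ \oo --> 0.
  apply: (quasi_decrease_cvg0 (fun k => C - \sum_(0 <= j < k) enorm (r j) ^+ 2) _
    (fun=> 0) 0 0%N) => [k|k|N|k _].
  - by rewrite subr_ge0.
  - exact: sqr_ge0.
  - by rewrite big1.
  - by rewrite big_nat_recr//= opprD addrA subrK addr0.
have smallr e : 0 < e -> \forall k \near \oo, enorm (r k) < e.
  move=> e0; have e20 : 0 < e ^+ 2 by rewrite exprn_gt0.
  have re : \forall k \near \oo, enorm (r k) ^+ 2 < e ^+ 2 by exact: (cvgr_lt _ r20).
  by apply: filterS re => k; rewrite ltr_pXn2r ?nnegrE ?enorm_ge0 ?(ltW e0).
have r0 : r @ \oo --> (0 : 'cV[R]_n).
  apply/cvg_enormP/cvgrPdist_lt => e /smallr; apply: filterS => k.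
  by rewrite subr0 sub0r normrN ger0_norm ?enorm_ge0.
have xbarE k : xbar k = x k - gam *: r k.
  by rewrite (zerofpr_r zf) scalerA divff ?gt_eqF// scale1r subKr.
have xbxs : xbar @ \oo --> xs.
  have -> : xbar = (fun k => x k - gam *: r k) by apply/funext.
  by rewrite -[X in _ --> X]subr0 -(scaler0 _ gam); apply: cvgB => //; exact: cvgZr.
(* [critical] gives a fixed point for some stepsize, possibly other than [gam]; for [gam] it follows
   by passing to the limit in xbar^k in T(x^k). *)
have Txs : fb_map f g gam xs xs.
  by apply: (fb_map_closed f g gam L gfL L0 x xbar) => //;
    [case: gpr|exact: (zerofpr_xbar zf)].
have [dRg sJ] := residual_differentiable f g gam xs S M gam0 dgf epi sdF Txs L gfL gamL.
have Jinj := residual_jacobian_injective f g gam xs S M gam0 dgf epi sdF Txs L gfL gamL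
  df xmin.
have Rg0 : Rg xs = 0 := residual_value0 f g gam xs sdF Txs.
rewrite -/Rg in dRg sJ Jinj; set J := jac Rg xs in sJ Jinj *.
have [c c0 cJ] := injective_mulmx_lower_bound J Jinj.
have frec e : 0 < e -> \forall z \near xs, enorm (Rg z - J *m (z - xs)) <= e * enorm (z - xs).
  move=> e0; have := differentiable_frechet _ _ dRg _ e0.
  by apply: filterS => z; rewrite Rg0 subr0.
(* Half of [c] absorbs the first-order remainder. *)
pose c2 := c / 2; have c20 : 0 < c2 by exact: divr_gt0.
have Rg_ge : \forall z \near xs, c2 * enorm (z - xs) <= enorm (Rg z).
  apply: filterS (frec c2 c20) => z zc; have := cJ (z - xs).
  have := enormB (Rg z) (Rg z - J *m (z - xs)); rewrite subKr.
  by move: zc; rewrite /c2; lra.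
pose K1 := Num.sqrt (frob2 J) + 1.
have K10 : 0 < K1 by rewrite ltr_wpDl// sqrtr_ge0.
have Rg_le : \forall z \near xs, enorm (Rg z) <= K1 * enorm (z - xs).
  apply: filterS (frec 1 ltr01) => z z1; have := enorm_mulmx_le J (z - xs).
  have := enormD (Rg z - J *m (z - xs)) (J *m (z - xs)); rewrite subrK.
  by move: z1; rewrite /K1; lra.
have Rx (P : set 'cV[R]_n) : (\forall z \near xs, P z) -> \forall k \near \oo, P (x k).
  exact: xxs.
have Rxb (P : set 'cV[R]_n) : (\forall z \near xs, P z) -> \forall k \near \oo, P (xbar k).
  exact: xbxs.
have r_in k : fb_residual f g gam (x k) (r k).
  by exists (xbar k); [exact: (zerofpr_xbar zf)|rewrite (zerofpr_r zf)].
have rE : \forall k \near \oo, r k = Rg (x k).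
  by apply: filterS (Rx _ sF) => k sk; exact: value_unique.
have rbE : \forall k \near \oo, rbar k = Rg (xbar k).
  by apply: filterS (Rxb _ sF) => k sk; apply: value_unique sk (broyden_rbar bd k).
(* The summand [gam] accounts for |xbar^k - x^k| = gam |r^k|, so one constant serves both
   sequences. *)
pose C1 := c2^-1 + gam; have C10 : 0 < C1 by rewrite addr_gt0// invr_gt0.
have x_le : \forall k \near \oo, enorm (x k - xs) <= C1 * enorm (r k).
  near=> k; have -> : r k = Rg (x k) by near: k.
  have : c2 * enorm (x k - xs) <= enorm (Rg (x k)).
    by near: k; exact: (Rx _ Rg_ge).
  rewrite mulrC -ler_pdivlMr// mulrC => h; apply: le_trans h _.
  by rewrite ler_wpM2r ?enorm_ge0// lerDl ltW.
have xb_le : \forall k \near \oo, enorm (xbar k - xs) <= C1 * enorm (r k).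
  near=> k; have : c2 * enorm (x k - xs) <= enorm (r k).
    have -> : r k = Rg (x k) by near: k.
    by near: k; exact: (Rx _ Rg_ge).
  rewrite mulrC -ler_pdivlMr// => h.
  have -> : xbar k - xs = (x k - xs) - gam *: r k by rewrite xbarE addrAC.
  apply: le_trans (enormB _ _) _; rewrite enormZ gtr0_norm// /C1 mulrDl.
  by rewrite lerD2r mulrC.
have r_le : \forall k \near \oo, enorm (r k) <= K1 * enorm (x k - xs).
  near=> k; have -> : r k = Rg (x k) by near: k.
  by near: k; exact: (Rx _ Rg_le).
have near_S (P : nat -> Prop) : (\forall k \near \oo, P k) -> \forall k \near \oo, P k.+1.
  by move=> [N _ NP]; exists N => // k /= Nk; apply: NP; exact: leqW.
have s0 := broyden_s bd.
have sE k : x k.+1 - xbar k = tau k *: d k by rewrite (zerofpr_x zf) addrC addKr.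
have tau0 k : 0 < tau k.
  by have [[m -> _] _] := zerofpr_tau zf k; rewrite exprn_gt0.
have d0 k : d k != 0.
  by apply/eqP => dk; have := s0 k; rewrite sE dk scaler0 eqxx.
have [dl [L' [dl0 L'0 lsdP]]] := lipschitz_semidifferentiable_estimate _ _ _ lsd sJ.
(* The factor 2 comes from (a + b)^2 <= 2 (a^2 + b^2). *)
pose A := 2 * (L' * C1) ^+ 2.
pose eta k := A * (enorm (r k) ^+ 2 + enorm (r k.+1) ^+ 2).
have A0 : 0 <= A by rewrite mulr_ge0// sqr_ge0.
have dev : \forall k \near \oo,
  (enorm (r k.+1 - rbar k - J *m (x k.+1 - xbar k)) / enorm (x k.+1 - xbar k)) ^+ 2 <= eta k.
  (* Residuals below this [e] keep x^{k+1} and xbar^k within the radius [dl] of the strict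
     estimate. *)
  pose e := dl / (2 * C1); have e0 : 0 < e by rewrite divr_gt0// mulr_gt0.
  near=> k.
  have rk : enorm (r k) < e by near: k; exact: smallr.
  have rk1 : enorm (r k.+1) < e by near: k; exact: (near_S _ (smallr _ e0)).
  have xk1 : enorm (x k.+1 - xs) <= C1 * enorm (r k.+1).
    by near: k; exact: (near_S _ x_le).
  have xbk : enorm (xbar k - xs) <= C1 * enorm (r k) by near: k.
  have rk1E : r k.+1 = Rg (x k.+1) by near: k; exact: (near_S _ rE).
  have rbkE : rbar k = Rg (xbar k) by near: k.
  pose m := C1 * (enorm (r k) + enorm (r k.+1)).
  have Cr := mulr_ge0 (ltW C10) (enorm_ge0 (r k)).
  have Cr1 := mulr_ge0 (ltW C10) (enorm_ge0 (r k.+1)).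
  have md : m < dl.
    rewrite /m -ltr_pdivlMl//; have -> : C1^-1 * dl = e + e.
      by rewrite /e; field; rewrite gt_eqF.
    exact: ltrD.
  have := lsdP (x k.+1) (xbar k) m md _ _; rewrite -/Rg -rk1E -rbkE => h.
  have {}h : enorm (r k.+1 - rbar k - J *m (x k.+1 - xbar k)) <=
      L' * m * enorm (x k.+1 - xbar k).
    by apply: h; rewrite /m mulrDr; [apply: le_trans xk1 _; rewrite lerDr|
      apply: le_trans xbk _; rewrite lerDl].
  have sk0 : 0 < enorm (x k.+1 - xbar k) by rewrite enorm_gt0.
  have h2 : enorm (r k.+1 - rbar k - J *m (x k.+1 - xbar k)) / enorm (x k.+1 - xbar k)
      <= L' * m by rewrite ler_pdivrMr.
  apply: (@le_trans _ _ ((L' * m) ^+ 2)).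
    by rewrite ler_pXn2r ?nnegrE ?divr_ge0 ?enorm_ge0// (le_trans _ h2)// divr_ge0 ?enorm_ge0.
  have -> : (L' * m) ^+ 2 = (L' * C1) ^+ 2 * (enorm (r k) + enorm (r k.+1)) ^+ 2.
    by rewrite /m; ring.
  have -> : eta k = (L' * C1) ^+ 2 * (2 * (enorm (r k) ^+ 2 + enorm (r k.+1) ^+ 2)).
    by rewrite /eta /A; ring.
  apply: ler_wpM2l; first exact: sqr_ge0.
  by have := sqr_ge0 (enorm (r k) - enorm (r k.+1)); lra.
have [K _ KP] := dev.
have sumr := sum_tail_le _ _ (fun k => sqr_ge0 (enorm (r k))) sumC.
have etaC N : \sum_(K <= k < N) eta k <= A * (C + C).
  rewrite -mulr_sumr big_split /= ler_wpM2l// lerD//.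
  apply: (sum_tail_le (fun k => enorm (r k.+1) ^+ 2)) => [k|N']; first exact: sqr_ge0.
  by rewrite -(big_add1 _ _ 0%N N'.+1 predT (fun k => enorm (r k) ^+ 2)); exact: sumr.
have [Hu dm0] := broyden_dennis_more thetabar H J _ _ eta K _ (broyden_thetabar bd)
  (broyden_init bd) s0 (broyden_H bd) KP etaC.
have dm : (fun k => enorm (rbar k + J *m d k) / enorm (d k)) @ \oo --> 0.
  rewrite (_ : (fun k => _) = (fun k => enorm ((invmx (H k) - J) *m (x k.+1 - xbar k))
      / enorm (x k.+1 - xbar k)))//.
  (* s_k is a positive multiple of d^k, and the inverse of H_k maps d^k to - rbar^k. *)
  apply/funext => k; rewrite sE -scalemxAr !enormZ gtr0_norm ?tau0//.
  have -> : (invmx (H k) - J) *m d k = - (rbar k + J *m d k).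
    by rewrite mulmxBl {1}(broyden_d bd) mulmxN mulKmx// opprD.
  have dk0 : 0 < enorm (d k) by rewrite enorm_gt0.
  by rewrite enormN; have := tau0 k => tk; field; rewrite !gt_eqF.
have step e : 0 < e -> \forall k \near \oo,
    enorm (xbar k - xs + d k) <= e * enorm (xbar k - xs).
  apply: (dennis_more_step J c _ _ rbar c0 cJ) => {}e e0.
    have /cvgrPdist_le/(_ _ e0) dme := dm; apply: filterS dme => k.
    rewrite sub0r normrN ger0_norm ?divr_ge0 ?enorm_ge0//.
    by rewrite ler_pdivrMr// enorm_gt0.
  near=> k; have -> : rbar k = Rg (xbar k) by near: k.
  by near: k; exact: (Rxb _ (frec _ e0)).
have tau1 : \forall k \near \oo, tau k = 1.
  (* With v = xbar^k - xs, the envelope at the unit trial point is at most phi(xs) + C2 |v + d^k|^2,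
     while Phi_k is eventually at least phi(xs) + th |r^k|^2. The margin th - sigma pays for the
     error. *)
  pose th := gam * (1 - gam * L) / 2.
  have th_s : 0 < th - sigma by rewrite subr_gt0 /th -mulrA.
  pose C2 := 3 / 2 * L + (2 * gam)^-1.
  have C20 : 0 <= C2 by rewrite addr_ge0// ?mulr_ge0// invr_ge0 mulr_ge0// ltW.
  pose D := C2 * C1 ^+ 2 + 1.
  have D0 : 0 < D by rewrite ltr_wpDl// mulr_ge0// sqr_ge0.
  (* The cap at 1 gives e^2 <= e, so a condition linear in [e] suffices. *)
  pose e := Num.min 1 ((th - sigma) / D).
  have e0 : 0 < e by rewrite lt_min ltr01 divr_gt0.
  have e1 : e <= 1 by rewrite ge_min lexx.
  have e2 : e * D <= th - sigma by rewrite -ler_pdivlMr// ge_min lexx orbT.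
  have [cm cm0 xminP] := xmin.
  near=> k.
  have vd : enorm (xbar k - xs + d k) <= e * enorm (xbar k - xs) by near: k; exact: step.
  have vr : enorm (xbar k - xs) <= C1 * enorm (r k) by near: k.
  have obj : (objective f g xs + (cm * enorm (xbar k - xs) ^+ 2)%:E <=
    objective f g (xbar k))%E by near: k; exact: (Rxb _ xminP).
  have [[m taum _] tauub] := zerofpr_tau zf k.
  apply/eqP; rewrite eq_le; apply/andP; split.
    by rewrite taum exprn_ile1// ltW.
  (* By maximality of tau_k it suffices that exponent 0, that is step 1, passes the test. *)
  apply: tauub; exists 0%N => //; rewrite scale1r leeBrDr//.
  apply: le_trans (envPhi k); apply: le_trans (envge k).
  apply: le_trans (leeD2r _ (fb_envelope_le f g gam L df gfL _ xs)) _.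
  rewrite -addeA -EFinD; apply: leeD; last first.
    rewrite lee_fin -/C2 -/th enorm_distC.
    rewrite (_ : xbar k + d k - xs = xbar k - xs + d k); last by rewrite addrAC.
    set a := enorm (xbar k - xs + d k) in vd *.
    have a0 : 0 <= a := enorm_ge0 _.
    have v0 : 0 <= enorm (xbar k - xs) := enorm_ge0 _.
    have r0' : 0 <= enorm (r k) := enorm_ge0 _.
    have aC : a ^+ 2 <= (e * (C1 * enorm (r k))) ^+ 2.
      rewrite ler_pXn2r ?nnegrE ?mulr_ge0 ?(ltW e0) ?(ltW C10)//.
      by apply: le_trans vd _; rewrite ler_pM2l.
    have ee : e ^+ 2 <= e by rewrite expr2 ler_piMr// ltW.
    have h1 : C2 * a ^+ 2 <= C2 * (C1 ^+ 2 * enorm (r k) ^+ 2) * e.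
      apply: le_trans (ler_wpM2l C20 aC) _.
      have -> : C2 * (e * (C1 * enorm (r k))) ^+ 2 =
          C2 * (C1 ^+ 2 * enorm (r k) ^+ 2) * e ^+ 2 by ring.
      apply: ler_wpM2l => //; apply: mulr_ge0 => //.
      by apply: mulr_ge0; exact: sqr_ge0.
    have h2 : e * D * enorm (r k) ^+ 2 <= (th - sigma) * enorm (r k) ^+ 2.
      by rewrite ler_wpM2r// sqr_ge0.
    have h3 : 0 <= e * enorm (r k) ^+ 2 by rewrite mulr_ge0 ?sqr_ge0// ltW.
    by move: h1 h2 h3; rewrite /D; lra.
  by apply: le_trans obj; rewrite leeDl// lee_fin mulr_ge0 ?sqr_ge0// ltW.
have xstep e : 0 < e -> \forall k \near \oo, enorm (x k.+1 - xs) <= e * enorm (xbar k - xs).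
  move=> e0; near=> k; have tk : tau k = 1 by near: k.
  by rewrite (zerofpr_x zf) tk scale1r addrAC; near: k; exact: (step _ e0).
(* [D] comes from |xbar^k - xs| <= C1 |r^k| <= C1 K1 |x^k - xs|; it carries the rate from one
   sequence to the next. *)
pose D := C1 * K1; have D0 : 0 < D by rewrite mulr_gt0.
split => //; split; apply: superlinear_small_ratio => [k|e e0].
- apply/eqP => xk; have := zerofpr_nostop zf k.
  have -> : r k = Rg (x k).
    by apply: value_unique (r_in k); rewrite xk; exact: nbhs_singleton sF.
  by rewrite xk Rg0 eqxx.
- have eD : 0 < e / D by exact: divr_gt0.
  near=> k.
  have h1 : enorm (x k.+1 - xs) <= e / D * enorm (xbar k - xs) by near: k; exact: (xstep _ eD).
  have h2 : enorm (xbar k - xs) <= C1 * enorm (r k) by near: k.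
  have h3 : enorm (r k) <= K1 * enorm (x k - xs) by near: k.
  apply: le_trans h1 _; rewrite -mulrA ler_pM2l// mulrC ler_pdivrMr//.
  apply: le_trans h2 _; rewrite (mulrC _ D) /D -mulrA ler_pM2l//.
(* xbar^k = xs would give rbar^k = 0 and hence d^k = 0. *)
- apply/eqP => xk; have := d0 k; rewrite (broyden_d bd).
  have -> : rbar k = Rg (xbar k).
    by apply: value_unique (broyden_rbar bd k); rewrite xk; exact: nbhs_singleton sF.
  by rewrite xk Rg0 mulmx0 oppr0 eqxx.
- have eD : 0 < e / D by exact: divr_gt0.
  near=> k.
  have h1 : enorm (x k.+1 - xs) <= e / D * enorm (xbar k - xs) by near: k; exact: (xstep _ eD).
  have h2 : enorm (xbar k.+1 - xs) <= C1 * enorm (r k.+1).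
    by near: k; exact: (near_S _ xb_le).
  have h3 : enorm (r k.+1) <= K1 * enorm (x k.+1 - xs).
    by near: k; exact: (near_S _ r_le).
  have h4 : C1 * enorm (r k.+1) <= D * enorm (x k.+1 - xs) by rewrite /D -mulrA ler_pM2l.
  apply: le_trans h2 _; apply: le_trans h4 _; rewrite mulrC -ler_pdivlMr//.
  by apply: le_trans h1 _; rewrite mulrAC.
- exact: (zerofpr_nostop zf).
- have eD : 0 < e / D by exact: divr_gt0.
  near=> k.
  have h1 : enorm (x k.+1 - xs) <= e / D * enorm (xbar k - xs) by near: k; exact: (xstep _ eD).
  have h2 : enorm (xbar k - xs) <= C1 * enorm (r k) by near: k.
  have h3 : enorm (r k.+1) <= K1 * enorm (x k.+1 - xs).
    by near: k; exact: (near_S _ r_le).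
  rewrite !subr0; apply: le_trans h3 _.
  rewrite mulrC -ler_pdivlMr//; apply: le_trans h1 _.
  apply: le_trans (ler_wpM2l (ltW eD) h2) _.
  rewrite le_eqVlt; apply/orP; left; apply/eqP; rewrite /D; field.
  by rewrite !gt_eqF.
Unshelve. all: by end_near. Qed.
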